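(* Let $L_+,L_-$ be self-adjoint operators on a Hilbert space $\mathcal{X}$ satisfying assumptions (P1) and (P2) of the context with $\omega_+>0$, and let $A$, $K$, $\mathcal{H}$ be as in the context. Let $N_A=\dim(\mathcal{H}_A^-\oplus\mathcal{H}_A^0\oplus\mathcal{H}_A^+)$ be the total number of isolated eigenvalues of $A$ and $N_K=\dim(\mathcal{H}_K^-\oplus\mathcal{H}_K^+)$ the total number of isolated eigenvalues of $K$. Assume that no embedded eigenvalues of the generalized eigenvalue problem $Au=\gamma Ku$, $u\in\mathcal{H}$, exist. Then the isolated eigenvalues of this problem satisfy $$N_p^-+N_p^0+N_p^++N_{c^+}\le N_A+N_K.$$
   Context: Let $\mathcal{X}$ be a Hilbert space with inner product $(\cdot,\cdot)$ and $L_\pm$ self-adjoint operators on it such that: (P1) the essential spectrum of $L_\pm$ consists of an absolutely continuous part $\sigma_c(L_\pm)$, bounded from below by $\omega_+\ge0$ for $L_+$ and by $\omega_->0$ for $L_-$, and finitely many embedded eigenvalues of finite multiplicities; (P2) the discrete spectrum of $L_\pm$ consists of finitely many isolated eigenvalues of finite multiplicities, with $p(L_\pm)$ positive, $z(L_\pm)$ zero and $n(L_\pm)$ negative eigenvalues (counted with multiplicity). Let $\mathcal{H}=\{u\in\mathcal{X}:u\perp\ker L_-\}$, let $\mathcal{P}$ be the orthogonal projection of $\mathcal{X}$ onto $\mathcal{H}$, and let $A=\mathcal{P}L_+\mathcal{P}$, $K=\mathcal{P}L_-^{-1}\mathcal{P}$, considered as self-adjoint operators on $\mathcal{H}$ ($K$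 is bounded with trivial kernel). There are orthogonal decompositions $\mathcal{H}=\mathcal{H}_K^-\oplus\mathcal{H}_K^+\oplus\mathcal{H}_K^{\sigma_e(K)}$ and $\mathcal{H}=\mathcal{H}_A^-\oplus\mathcal{H}_A^0\oplus\mathcal{H}_A^+\oplus\mathcal{H}_A^{\sigma_e(A)}$ into invariant subspaces, where $-$, $0$, $+$ refer to the negative, zero, positive isolated eigenvalues and $\sigma_e$ to the essential spectrum (absolutely continuous part and embedded eigenvalues); $\sigma_e(K)\subset(0,\omega_-^{-1}]$ and $\sigma_e(A)\subset[\omega_+,\infty)$. Put $[u,v]=(Ku,v)$. Eigenvalues $\gamma$ of $Au=\gamma Ku$ are those of $K^{-1}A$. For a real isolated eigenvalue $\gamma_0$ with generalized eigenspace $\mathcal{H}_{\gamma_0}$ (span of all Jordan chains), $N_p(\gamma_0)$ is the maximal dimension of a subspace of $\mathcal{H}_{\gamma_0}$ on which $[u,u]\ge0$. Explicitly, for a single Jordan chain $f_1,\dots,f_n$: $N_p=k$ if $n=2k$; if $n=2k+1$, $N_p=k+1$ when $[f_1,f_n]>0$ and $N_p=k$ when $[f_1,f_n]<0$. $N_p^-$, $N_p^0$, $N_p^+$ are the sums of $N_p(\gamma_0)$ over eigenvalues $\gamma_0<0$, $\gamma_0=0$, $\gamma_0>0$ respectively. $N_{c^+}$ is the number of complex eigenvalues with $\operatorname{Im}\gamma>0$, with algebraic multiplicity.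
   Formalization: ''No embedded eigenvalues'' is taken as: no eigenvalue of Au = γKu in [ω₊ω₋, ∞), isolated ones included; if only eigenvalues in the essential spectrum of the problem are excluded, the bound can fail (infinitely many isolated eigenvalues above ω₊ω₋ with N_A = N_K = 0). *)

(* Defs.v *)
From HB Require Import structures.
From mathcomp Require Import all_boot all_order all_algebra sesquilinear.
From mathcomp Require Import complex.
From mathcomp Require Import all_classical all_reals all_analysis.

Set Implicit Arguments.
Unset Strict Implicit.
Unset Printing Implicit Defensive.

Import Order.TTheory GRing.Theory Num.Theory numFieldNormedType.Exports.

Local Open Scope classical_set_scope.
Local Open Scope complex_scope.
Local Open Scope ring_scope.

(* A complex Hilbert space is a complete normed module over R[i] whose norm is
   induced by a positive definite Hermitian form, linear in its first argument.
   In the partial order of R[i], [a <= b] forces [a] and [b] to have the same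
   imaginary part; hence [0 < g], [g < 0] and [w%:C <= g] all entail that [g]
   is real.

   An unbounded operator is represented by its graph, a set of pairs
   (u, T u). This makes domains explicit and lets the inverse of an operator
   with nontrivial kernel be a (multivalued) relation. *)

Section Operators.
Variables (R : realType) (X : completeNormedModType R[i]).
Implicit Types (S M : set X) (T : set (X * X)) (g : R[i]).

Definition inner_product_compatible (ip : {dot X for Num.conj}) : Prop :=
  forall u : X, ip u u = `|u| ^+ 2.

Definition lin_indep n (v : 'I_n -> X) : Prop :=
  forall c : 'I_n -> R[i], \sum_i c i *: v i = 0 -> forall i, c i = 0.

(* For an arbitrary set S this is the dimension of its linear span. *)
Definition dim S : \bar R :=
  ereal_sup [set (n%:R)%:E | n in
    [set n | exists v : 'I_n -> X, (forall i, S (v i)) /\ lin_indep v]].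

Definition lspan S : set X :=
  [set u | exists n (c : 'I_n -> R[i]) (v : 'I_n -> X),
     (forall i, S (v i)) /\ u = \sum_i c i *: v i].

Definition subspace S : Prop :=
  S 0 /\ forall (a : R[i]) u v, S u -> S v -> S (a *: u + v).

Definition sum_space S S' : set X := [set u + v | u in S & v in S'].

Definition dom T : set X := [set u | exists w, T (u, w)].

Definition ker T : set X := [set u | T (u, 0)].

Definition inverse T : set (X * X) := [set uw | T (uw.2, uw.1)].

Definition restrict M T : set (X * X) := [set uw | [/\ M uw.1, M uw.2 & T uw]].

Definition eigenspace T g : set X := [set u | T (u, g *: u)].

Definition eigenvalue T g : Prop := exists2 u, u != 0 & eigenspace T g u.

(* The set of u with (T - g)^n u = 0 for some n, that is, of all vectors of
   the Jordan chains (T - g) (f j.+1) = f j, f 0 = 0; it is a subspace. *)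
Definition gen_eigenspace T g : set X :=
  [set u | exists n (f : nat -> X), [/\ f 0%N = 0, f n = u &
     forall j, (j < n)%N -> T (f j.+1, g *: f j.+1 + f j)]].

(* Here T is an operator in the closed subspace M (its domain and its range
   are contained in M). *)
Definition resolvent_set M T : set R[i] :=
  [set g | (exists c : R, forall u w, T (u, w) ->
              `|u| <= c%:C * `|w - g *: u|) /\
           (forall f, M f -> exists u w, T (u, w) /\ w - g *: u = f)].

Definition spectrum M T : set (R[i] : numFieldType) := ~` resolvent_set M T.

Definition isolated_eigenvalue M T g : Prop :=
  eigenvalue T g /\ isolated (spectrum M T) g.

Definition discrete_spectrum M T : set R[i] :=
  [set g | isolated_eigenvalue M T g /\ (dim (eigenspace T g) < +oo)%E].

Definition essential_spectrum M T : set R[i] :=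
  spectrum M T `\` discrete_spectrum M T.

(* The span of the eigenvectors for the isolated eigenvalues (of finite
   multiplicity) in J. *)
Definition isolated_subspace M T (J : set R[i]) : set X :=
  lspan [set u | exists2 g, (discrete_spectrum M T `&` J) g & eigenspace T g u].

End Operators.

Section Hilbert.
Variables (R : realType) (X : completeNormedModType R[i]).
Variable (ip : {dot X for Num.conj}).
Implicit Types (S M : set X) (T L A K : set (X * X)) (g : R[i]).

Definition ortho S : set X := [set u | forall v, S v -> ip u v = 0].

Definition adjoint T : set (X * X) :=
  [set vw | forall u w, T (u, w) -> ip w vw.1 = ip u vw.2].

Definition self_adjoint T : Prop := dense (dom T) /\ adjoint T = T.

(* [mu] is the measure B |-> (E(B) u, u), E being the spectral measure of L:
   it is characterized by ((L - z)^-1 u, u) = \int dmu(x) / (x - z). *)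
Definition is_spectral_measure L (u : X)
    (mu : {finite_measure set (measurableTypeR R) -> \bar R}) : Prop :=
  forall z v, complex.Im z != 0 -> L (v, u + z *: v) ->
    complex.Re (ip v u) =
      Rintegral mu setT (fun x => complex.Re (x%:C - z)^-1) /\
    complex.Im (ip v u) =
      Rintegral mu setT (fun x => complex.Im (x%:C - z)^-1).

Definition ac_subspace L : set X :=
  [set u | exists2 mu, is_spectral_measure L u mu &
     mu `<< (@lebesgue_measure R)].

Definition ac_spectrum L : set R[i] :=
  spectrum (ac_subspace L) (restrict (ac_subspace L) L).

Definition embedded_eigenvalues L : set R[i] :=
  [set g | eigenvalue L g /\ ac_spectrum L g].

(* The essential spectrum is purely absolutely continuous as a set; eigenvalues
   embedded in it are allowed but finite in number and of finite multiplicity. *)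
Definition essential_spectrum_assumption L (om : R) : Prop :=
  [/\ essential_spectrum setT L = ac_spectrum L `|` embedded_eigenvalues L,
      forall g, ac_spectrum L g -> om%:C <= g,
      finite_set (embedded_eigenvalues L) &
      forall g, embedded_eigenvalues L g -> (dim (eigenspace L g) < +oo)%E].

(* Finiteness of the multiplicities is part of the definition of the discrete
   spectrum. *)
Definition discrete_spectrum_assumption L : Prop :=
  finite_set (discrete_spectrum setT L).

Definition orth_proj M : set (X * X) :=
  [set wp | M wp.2 /\ ortho M (wp.1 - wp.2)].

(* The operator P T P in M, P being the orthogonal projection onto M. *)
Definition compression M T : set (X * X) :=
  [set ua | M ua.1 /\ exists2 w, T (ua.1, w) & orth_proj M (w, ua.2)].

Definition spaceH Lm : set X := ortho (ker Lm).

Definition opA Lp Lm : set (X * X) := compression (spaceH Lm) Lp.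

(* [inverse Lm] is multivalued when ker Lm is nontrivial, but its values at a
   point differ by elements of ker Lm, which the projection kills. *)
Definition opK Lm : set (X * X) := compression (spaceH Lm) (inverse Lm).

(* The graph of K^-1 A: the eigenvalue problem for it is A u = g K u. *)
Definition pencil A K : set (X * X) :=
  [set uw | exists2 f, A (uw.1, f) & K (uw.2, f)].

(* [u, v] = (K u, v) *)
Definition bracket K (u v : X) : R[i] := ip (xget 0 [set k | K (u, k)]) v.

Definition Np A K g : \bar R :=
  ereal_sup [set dim W | W in
    [set W | [/\ subspace W, W `<=` gen_eigenspace (pencil A K) g &
                 forall u, W u -> 0 <= bracket K u u]]].

Definition Np_neg M A K : \bar R :=
  \esum_(g in [set g | isolated_eigenvalue M (pencil A K) g /\ g < 0]) Np A K g.

Definition Np_zero M A K : \bar R :=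
  \esum_(g in [set g | isolated_eigenvalue M (pencil A K) g /\ g = 0]) Np A K g.

Definition Np_pos M A K : \bar R :=
  \esum_(g in [set g | isolated_eigenvalue M (pencil A K) g /\ 0 < g]) Np A K g.

Definition Nc_plus A K : \bar R :=
  \esum_(g in [set g | eigenvalue (pencil A K) g /\ (0 < complex.Im g)%R])
    dim (gen_eigenspace (pencil A K) g).

Definition N_A M A : \bar R :=
  dim (sum_space (sum_space (isolated_subspace M A [set g | g < 0])
                            (isolated_subspace M A [set g | g = 0]))
                 (isolated_subspace M A [set g | 0 < g])).

Definition N_K M K : \bar R :=
  dim (sum_space (isolated_subspace M K [set g | g < 0])
                 (isolated_subspace M K [set g | 0 < g])).

(* Since sigma_e(A) lies in [omp, +oo[ and sigma_e(K) in ]0, omm^-1], the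
   essential spectrum of A u = g K u is carried by the half-line
   [omp * omm, +oo[, and "embedded" refers to that half-line. The smaller set
   sigma_e(K^-1 A) would not do: it can be empty although L_+ and L_- have no
   eigenvalue at all, and K^-1 A then has infinitely many isolated eigenvalues
   above omp * omm, all of positive type. *)
Definition embedded_pencil_eigenvalue A K (omp omm : R) g : Prop :=
  eigenvalue (pencil A K) g /\ (omp * omm)%:C <= g.

End Hilbert.

(* Main.v *)
Require Import Defs.
From HB Require Import structures.
From mathcomp Require Import all_boot all_order all_algebra sesquilinear.
From mathcomp Require Import complex.
From mathcomp Require Import all_classical all_reals all_analysis.
From mathcomp Require Import ring lra.

(** Write [u, v] = (K u, v). An eigenvector of A or K for an isolated eigenvalue
    of finite multiplicity is called discrete below. The count rests on two facts.

    - A vector u orthogonal to all discrete eigenvectors of A and of K satisfies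
      omp |u|^2 <= (A u, u) and [u, u] <= |u|^2 / omm ([opA_form_bound],
      [opK_form_bound]). For 0 <= s < omp * omm, the form s [u, u] - (A u, u) is
      therefore negative at u unless u = 0. Hence a space of vectors on which
      this form is nonnegative has dimension at most N_A + N_K: otherwise it
      would contain some u <> 0 orthogonal to the N_A + N_K vectors that span
      the isolated subspaces ([nonneg_family_count]).

    - The eigenvalues in the closed upper half-plane supply such a space. Their
      root spaces are linearly independent and mutually orthogonal for both
      forms, so it suffices to work in one root space at a time. Both forms
      vanish on the root space of a nonreal eigenvalue. Let g be real. Since
      the half-line [omp * omm, +oo[ contains no eigenvalue, s can be chosen
      above the finitely many real eigenvalues in play. On the root space
      A u = K (g u + N u), where N is locally nilpotent and symmetric for
      [ , ], so that s [u, u] - (A u, u) = [(s - g - N) u, u]. As s - g > 0,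
      the operator s - g - N has an inverse square root p(N), with p a real
      polynomial, and u = p(N) x gives [(s - g - N) u, u] = [x, x]. So p(N)
      carries a space on which [x, x] >= 0 to one of the same dimension on
      which the form is nonnegative ([shifted_form_family]).

    The bounds of the first fact are obtained without the spectral theorem.
    Everything follows from [form_lower_bound]: if T - k is bounded below for
    every real k < k0, then T >= k0. A bounded resolvent reduces this to a
    bounded operator R, and there a positive form P = R - m that is bounded
    below as an operator is bounded away from 0 as a form. Two further
    ingredients produce the lower bounds of T - k. At an isolated point m of the
    spectrum, (T - m)^-1 on the complement of the kernel has its spectrum in a
    bounded interval, hence is bounded ([isolated_gap]); this makes L+ and L-
    at least omp and omm on the complement of finitely many vectors
    ([finite_codim_form_bound]). Conversely a lower bound for T - k on a
    subspace of finite codimension extends to the complement of the discrete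
    eigenvectors ([bounded_below_discrete]), because an eigenvalue k of such a T
    is isolated and of finite multiplicity. Compression to H and inversion
    preserve bounds on subspaces of finite codimension, so the second principle
    applies to A and K.

    All estimates are between squared real norms [sq u]; unbounded operators
    are graphs, and a graph is self-adjoint in a closed subspace if it is symmetric
    and contains its adjoint relative to that subspace. *)

Set Implicit Arguments.
Unset Strict Implicit.
Unset Printing Implicit Defensive.
Import Order.TTheory GRing.Theory Num.Theory numFieldNormedType.Exports.
Local Open Scope classical_set_scope.
Local Open Scope complex_scope.
Local Open Scope ring_scope.

(** * Inner product geometry and completeness *)

Section Geometry.
Variables (R : realType) (X : completeNormedModType R[i]).
Variable ip : {dot X for Num.conj}.
Local Notation subspace := Defs.subspace.
Local Notation ortho := Defs.ortho.

Definition re (u v : X) : R := complex.Re (ip u v).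

(** Squared norms are real numbers, which keeps all estimates in [R] and avoids
    square roots. *)
Definition sq (u : X) : R := re u u.

Lemma cReD (x y : R[i]) : complex.Re (x + y) = complex.Re x + complex.Re y.
Proof. by case: x => ? ?; case: y. Qed.

Lemma cReN (x : R[i]) : complex.Re (- x) = - complex.Re x.
Proof. by case: x. Qed.

Lemma cImN (x : R[i]) : complex.Im (- x) = - complex.Im x.
Proof. by case: x. Qed.

Lemma cReM (x y : R[i]) : complex.Re (x * y) =
  complex.Re x * complex.Re y - complex.Im x * complex.Im y.
Proof. by case: x => ? ?; case: y. Qed.

Lemma cImM (x y : R[i]) : complex.Im (x * y) =
  complex.Re x * complex.Im y + complex.Im x * complex.Re y.
Proof. by case: x => ? ?; case: y. Qed.

Lemma cReJ (x : R[i]) : complex.Re (Num.conj x) = complex.Re x.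
Proof. by case: x. Qed.

Lemma cImJ (x : R[i]) : complex.Im (Num.conj x) = - complex.Im x.
Proof. by case: x. Qed.

Lemma ipDl u v w : ip (u + v) w = ip u w + ip v w. Proof. exact: linearDl. Qed.

Lemma ipDr u v w : ip w (u + v) = ip w u + ip w v. Proof. exact: linearDr. Qed.

Lemma ipNl u w : ip (- u) w = - ip u w. Proof. exact: linearNl. Qed.

Lemma ipNr u w : ip w (- u) = - ip w u. Proof. exact: linearNr. Qed.

Lemma ipBl u v w : ip (u - v) w = ip u w - ip v w. Proof. exact: linearBl. Qed.

Lemma ipBr u v w : ip w (u - v) = ip w u - ip w v. Proof. exact: linearBr. Qed.

Lemma ip0l w : ip 0 w = 0. Proof. exact: linear0l. Qed.

Lemma ip0r w : ip w 0 = 0. Proof. exact: linear0r. Qed.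

Lemma ipZl a u w : ip (a *: u) w = a * ip u w. Proof. exact: linearZl_LR. Qed.

Lemma ipZr a u w : ip w (a *: u) = Num.conj a * ip w u.
Proof. exact: linearZr_LR. Qed.

Lemma ipC u v : ip u v = Num.conj (ip v u).
Proof. by rewrite hermC mul1r. Qed.

Lemma ip_sum_l I (r : seq I) (P : pred I) F v :
  ip (\sum_(i <- r | P i) F i) v = \sum_(i <- r | P i) ip (F i) v.
Proof. exact: linear_sumlz. Qed.

Lemma ip_sum_r I (r : seq I) (P : pred I) F v :
  ip v (\sum_(i <- r | P i) F i) = \sum_(i <- r | P i) ip v (F i).
Proof. exact: linear_sumr. Qed.

Lemma reC u v : re u v = re v u.
Proof. by rewrite /re ipC cReJ. Qed.

Lemma reDl u v w : re (u + v) w = re u w + re v w.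
Proof. by rewrite /re ipDl cReD. Qed.

Lemma reDr u v w : re w (u + v) = re w u + re w v.
Proof. by rewrite /re ipDr cReD. Qed.

Lemma reNl u w : re (- u) w = - re u w.
Proof. by rewrite /re ipNl cReN. Qed.

Lemma reNr u w : re w (- u) = - re w u.
Proof. by rewrite /re ipNr cReN. Qed.

Lemma reZl (a : R) u w : re (a%:C *: u) w = a * re u w.
Proof. by rewrite /re ipZl cReM /= mul0r subr0. Qed.

Lemma reZr (a : R) u w : re w (a%:C *: u) = a * re w u.
Proof. by rewrite reC reZl reC. Qed.

Lemma re0l w : re 0 w = 0. Proof. by rewrite /re ip0l. Qed.

Lemma re0r w : re w 0 = 0. Proof. by rewrite /re ip0r. Qed.

Definition reE := (reDl, reDr, reNl, reNr, reZl, reZr).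

Lemma ipuu u : ip u u = (sq u)%:C.
Proof.
apply/eqP; rewrite eq_complex /= eqxx /=; apply/eqP.
have := congr1 (@complex.Im R) (ipC u u); rewrite cImJ; lra.
Qed.

Lemma sq_ge0 u : 0 <= sq u.
Proof. by have := dnorm_ge0 ip u; rewrite ipuu lecR. Qed.

Lemma sq_eq0 u : sq u = 0 -> u = 0.
Proof. by move=> h; apply/eqP; rewrite -(dnorm_eq0 ip) ipuu h. Qed.

Lemma sq0 : sq 0 = 0. Proof. exact: re0l. Qed.

Lemma sqN u : sq (- u) = sq u. Proof. by rewrite /sq !reE opprK. Qed.

Lemma sqBC u v : sq (u - v) = sq (v - u).
Proof. by rewrite -sqN opprB. Qed.

Lemma sqZ (g : R[i]) u :
  sq (g *: u) = (complex.Re g ^+ 2 + complex.Im g ^+ 2) * sq u.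
Proof.
rewrite /sq /re ipZl ipZr mulrA ipuu.
case: g => a b /=; ring.
Qed.

Lemma sqD_le u v : sq (u + v) <= 2 * sq u + 2 * sq v.
Proof. have := sq_ge0 (u - v); rewrite /sq !reE (reC v u); lra. Qed.

Lemma re_le u v : 2 * re u v <= sq u + sq v.
Proof. have := sq_ge0 (u - v); rewrite /sq !reE (reC v u); lra. Qed.

Lemma reBZ (t : R) a b c d : re (a - t%:C *: b) (c - t%:C *: d) =
  re a c - t * re a d - t * re b c + t ^+ 2 * re b d.
Proof. rewrite !reE; ring. Qed.

Lemma sqBZ (t : R) a b : sq (a - t%:C *: b) = sq a - 2 * t * re a b + t ^+ 2 * sq b.
Proof. rewrite /sq reBZ (reC b a); ring. Qed.

Lemma sqB a b : sq (a - b) = sq a - 2 * re a b + sq b.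
Proof. by have := sqBZ 1 a b; rewrite scale1r => ->; ring. Qed.

Lemma cauchy_schwarz u v : re u v ^+ 2 <= sq u * sq v.
Proof.
have [v0|v0] := eqVneq (sq v) 0.
  by rewrite (sq_eq0 v0) re0r sq0 expr0n mulr0.
have := sq_ge0 ((sq v)%:C *: u - (re u v)%:C *: v).
rewrite /sq !reE (reC v u) -/(sq u) -/(sq v).
have vp : 0 < sq v by rewrite lt_def v0 sq_ge0.
set a := sq u; set b := sq v; set c := re u v => h.
have {h} : 0 <= b * (a * b - c ^+ 2).
  by apply: le_trans h _; rewrite le_eqVlt; apply/orP; left; apply/eqP; ring.
by rewrite pmulr_rge0 // subr_ge0.
Qed.

Lemma ImE u v : complex.Im (ip u v) = - re ('i *: u) v.
Proof. by rewrite /re ipZl cReM /=; ring. Qed.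

(** The imaginary part of [ip u v] is a real part at ['i *: u], so complex
    identities follow from real ones that hold on complex subspaces. *)
Lemma ip_eq u v u' v' : re u v = re u' v' -> re ('i *: u) v = re ('i *: u') v' ->
  ip u v = ip u' v'.
Proof.
move=> h1 h2; apply/eqP; rewrite eq_complex; apply/andP; split; apply/eqP.
  exact: h1.
by rewrite !ImE h2.
Qed.

(** The norm closure of [V]. *)
Definition adh (V : set X) : set X :=
  [set p | forall e : R, 0 < e -> exists2 v, V v & sq (v - p) < e].

Definition closed_subspace (M : set X) : Prop := subspace M /\ adh M `<=` M.

Lemma re_adh0 (V : set X) p e : adh V p -> (forall v, V v -> re v e = 0) ->
  re p e = 0.
Proof.
move=> hp hV; apply/eqP/negPn/negP => n0.
have sqnormc : 0 < re p e ^+ 2 by rewrite exprn_even_gt0.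
have e0 : 0 < 1 + sq e by have := sq_ge0 e; lra.
have [v Vv] := hp _ (divr_gt0 sqnormc e0).
rewrite ltr_pdivlMr // => h.
have := cauchy_schwarz (v - p) e; rewrite reDl reNl (hV v Vv) add0r sqrrN.
have := sq_ge0 (v - p); nra.
Qed.

Lemma ip_adh0 (V : set X) p e : adh V p -> (forall v, V v -> ip v e = 0) ->
  ip p e = 0.
Proof.
move=> hp hV; rewrite -(ip0l e); apply: ip_eq; rewrite ?scaler0 re0l.
  by apply: re_adh0 hp _ => v Vv; rewrite /re hV.
apply: (@re_adh0 [set 'i *: v | v in V]) => [eps eps0|_ [v Vv <-]].
  have [v Vv h] := hp _ eps0; exists ('i *: v); first by exists v.
  by rewrite -scalerBr sqZ /= expr0n expr1n add0r mul1r.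
by rewrite /re ipZl hV // mulr0.
Qed.

Lemma ortho_closed S : closed_subspace (ortho ip S).
Proof.
split; first split.
- by move=> v _; rewrite ip0l.
- by move=> a u v hu hv w Sw; rewrite ipDl ipZl hu // hv // mulr0 addr0.
- by move=> p hp v Sv; apply: ip_adh0 hp _ => w hw; exact: hw.
Qed.

Hypothesis ipn : inner_product_compatible ip.

Lemma normE u : `|u| = (Num.sqrt (sq u))%:C.
Proof.
have n0 : 0 <= `|u| by [].
have := ipn u; rewrite ipuu; case: `|u| n0 => a b.
rewrite lecE /= => /andP[/eqP-> a0]; rewrite expr2 => -[].
by rewrite mulr0 subr0 => -> _; rewrite -expr2 sqrtr_sqr ger0_norm.
Qed.

Lemma norm_lt u (r : R) : 0 < r -> (`|u| < r%:C) = (sq u < r ^+ 2).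
Proof.
move=> r0; rewrite normE ltcR -[X in _ = (_ < X)]sqr_sqrtr ?sqr_ge0 //.
rewrite -[in RHS](sqr_sqrtr (sq_ge0 u)) ltr_pXn2r ?nnegrE ?sqrtr_ge0 //.
by rewrite sqrtr_sqr ger0_norm // ltW.
Qed.

Lemma norm_le u v (c : R) : 0 <= c ->
  (`|u| <= c%:C * `|v|) = (sq u <= c ^+ 2 * sq v).
Proof.
move=> c0; rewrite !normE -rmorphM lecR -[c in LHS]ger0_norm // -sqrtr_sqr.
by rewrite -sqrtrM ?sqr_ge0 // ler_sqrt // mulr_ge0 ?sqr_ge0 ?sq_ge0.
Qed.

Lemma pos_complex (e : R[i]) : 0 < e -> exists2 r : R, 0 < r & e = r%:C.
Proof.
case: e => a b; rewrite ltcE /= => /andP[/eqP-> a0]; by exists a.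
Qed.

(** Completeness for a decreasing family of sets of vanishing diameter; this
    form replaces Cauchy sequences, so that no sequence has to be chosen. *)
Lemma complete_family (F : R -> set X) :
  (forall d : R, 0 < d -> F d !=set0) ->
  (forall d d' : R, 0 < d -> d <= d' -> F d `<=` F d') ->
  (forall e : R, 0 < e -> exists2 d : R, 0 < d &
    forall u v, F d u -> F d v -> sq (u - v) < e) ->
  exists l, forall e d : R, 0 < e -> 0 < d -> exists2 u, F d u & sq (u - l) < e.
Proof.
move=> Fne Fmon Fcau.
pose G := filter_from [set d : R | 0 < d] F.
have FG : ProperFilter G.
  apply: filter_from_proper; last by move=> d d0; exact: Fne.
  apply: filter_from_filter; first by exists 1; rewrite /=.
  move=> d d' /= d0 d'0; exists (Num.min d d'); first by rewrite /= lt_min d0.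
  have m0 : 0 < Num.min d d' by rewrite lt_min d0.
  move=> u hu; split; apply: Fmon m0 _ _ hu; by rewrite ge_min lexx ?orbT.
have cG : cauchy G.
  apply: cauchy_exP => _ /pos_complex[r r0 ->].
  have [d d0 hd] := Fcau _ (exprn_gt0 2 r0).
  have [u hu] := Fne _ d0; exists u; exists d => // v hv.
  by rewrite -ball_normE /= norm_lt //; exact: hd.
pose l := lim G; have hl : G --> l := cauchy_cvg G cG.
exists l => e d e0 d0.
have /hl : nbhs l (ball l (Num.sqrt e)%:C).
  by apply: nbhsx_ballx; rewrite ltcR sqrtr_gt0.
move=> [d' d'0 hd'].
have m0 : 0 < Num.min d d' by rewrite lt_min d0.
have [u hu] := Fne _ m0; exists u.
  by apply: Fmon m0 _ _ hu; rewrite ge_min lexx.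
have /hd' : F d' u by apply: Fmon m0 _ _ hu; rewrite ge_min lexx ?orbT.
rewrite -ball_normE /= norm_lt ?sqrtr_gt0 // sqr_sqrtr ?(ltW e0) //.
by rewrite sqBC.
Qed.

End Geometry.

(** * Self-adjoint graphs in a closed subspace *)

Section Relations.
Variables (R : realType) (X : completeNormedModType R[i]).
Variable ip : {dot X for Num.conj}.
Local Notation subspace := Defs.subspace.
Local Notation ortho := (Defs.ortho ip).
Local Notation restrict := Defs.restrict.
Local Notation re := (re ip).
Local Notation sq := (sq ip).
Local Notation adh := (adh ip).

Hypothesis ipn : inner_product_compatible ip.

Lemma subD V u v : @subspace R X V -> V u -> V v -> V (u + v).
Proof. by move=> [_ h] Vu Vv; have := h 1 _ _ Vu Vv; rewrite scale1r. Qed.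

Lemma subZ V a u : @subspace R X V -> V u -> V (a *: u).
Proof. by move=> [h0 h] Vu; have := h a _ _ Vu h0; rewrite addr0. Qed.

Lemma subB V u v : @subspace R X V -> V u -> V v -> V (u - v).
Proof. by move=> hV Vu Vv; apply: subD => //; rewrite -scaleN1r; apply: subZ. Qed.

Lemma le0_of_le_eps (a : R) : (forall e : R, 0 < e -> a <= e) -> a <= 0.
Proof.
move=> h; rewrite leNgt; apply/negP => a0.
by have := h (a / 2); lra.
Qed.

(** Minimizing sequences for the distance to [V] are Cauchy by the
    parallelogram law. As [V] need not be closed, the projection is only in
    its closure; applied to a range, this turns an orthogonality argument into
    density. *)
Lemma projection (V : set X) u : subspace V ->
  exists p, adh V p /\ forall v, V v -> ip (u - p) v = 0.
Proof.
move=> sV; pose D := inf [set sq (u - v) | v in V].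
have hD v : V v -> D <= sq (u - v).
  move=> Vv; apply: ge_inf; last by exists v.
  by exists 0 => _ [w _ <-]; exact: sq_ge0.
have hlb : has_inf [set sq (u - v) | v in V].
  split; first by exists (sq (u - 0)), 0 => //; case: sV.
  by exists 0 => _ [w _ <-]; exact: sq_ge0.
pose F (d : R) := [set v | V v /\ sq (u - v) < D + d].
(* a vector that almost minimizes the distance is almost orthogonal to [V] *)
have small d v w : F d w -> V v -> re (u - w) v ^+ 2 <= d * sq v.
  move=> [Vw hw] Vv; have [v0|v0] := eqVneq (sq v) 0.
    by rewrite (sq_eq0 v0) re0r expr0n sq0 mulr0.
  have vp : 0 < sq v by rewrite lt_def v0 sq_ge0.
  pose t := re (u - w) v / sq v.
  have := hD (w + t%:C *: v) (subD sV Vw (subZ _ sV Vv)).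
  rewrite opprD addrA.
  have -> : sq (u - w - t%:C *: v) =
     sq (u - w) - 2 * t * re (u - w) v + t ^+ 2 * sq v.
    by rewrite /sq (reDl ip (u - w)) !(reDr ip (u - w)) !reNl !reNr !reZl !reZr
       (reC ip v); ring.
  have et : re (u - w) v = t * sq v by rewrite /t divfK.
  rewrite et => h.
  have -> : (t * sq v) ^+ 2 = t ^+ 2 * sq v * sq v by ring.
  by rewrite ler_pM2r //; lra.
have [|||p hp] := complete_family ipn (F := F).
- move=> d d0; have [_ [v Vv <-] h] := inf_adherent d0 hlb.
  by exists v; split.
- by move=> d d' d0 dd v [Vv hv]; split => //; lra.
- move=> e e0; exists (e / 5); first by rewrite divr_gt0.
  move=> v w [Vv hv] [Vw hw].
  have := hD (2^-1%:C *: (v + w)) (subZ _ sV (subD sV Vv Vw)).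
  rewrite /sq !reE (reC ip v u) (reC ip w u) (reC ip w v).
  move: hv hw; rewrite /sq !reE (reC ip v u) (reC ip w u) => *; lra.
have ap : adh V p.
  by move=> e e0; have [v [Vv _] h] := hp e 1 e0 ltr01; exists v.
exists p; split => // v Vv.
have key v' : V v' -> re (u - p) v' = 0.
  move=> Vv'; apply/eqP; rewrite -sqrf_eq0 eq_le sqr_ge0 andbT.
  apply: le0_of_le_eps => e e0.
  have s0 : 0 < 4 * (1 + sq v') by have := sq_ge0 ip v'; lra.
  have d0 : 0 < e / (4 * (1 + sq v')) by rewrite divr_gt0.
  have [w Fw hw] := hp _ _ d0 d0.
  have h1 := small _ _ _ Fw Vv'.
  have h2 := cauchy_schwarz ip (w - p) v'.
  move: h1 hw d0 h2; set d := e / _ => h1 hw d0 h2.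
  have de : d * (4 * (1 + sq v')) = e by rewrite /d divfK // gt_eqF.
  have -> : re (u - p) v' = re (u - w) v' + re (w - p) v'.
    by rewrite -reDl; congr (re _ _); rewrite addrA subrK.
  have := sq_ge0 ip v'; have := sqr_ge0 (re (u - w) v' - re (w - p) v').
  have := sq_ge0 ip (w - p); nra.
rewrite -(ip0l ip v); apply: ip_eq; first by rewrite re0l key.
rewrite scaler0 re0l -(key (Num.conj 'i *: v)); last exact: subZ.
rewrite /re ipZl ipZr; congr (complex.Re (_ * _)).
by rewrite [RHS]conjcK.
Qed.

Implicit Types (T : set (X * X)) (M : set X).

(** A graph [T] in the closed subspace [M] that equals its own adjoint relative
    to [M]. Density of the domain is not part of the definition, so that inverses
    stay in the class. *)
Definition self_adjoint_in M T : Prop :=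
  [/\ closed_subspace ip M,
      forall u w, T (u, w) -> M u /\ M w,
      forall u w v z, T (u, w) -> T (v, z) -> ip w v = ip u z &
      forall v z, M v -> M z ->
        (forall u w, T (u, w) -> ip w v = ip u z) -> T (v, z)].
Local Notation SA := self_adjoint_in.

Definition bounded_below T (g : R[i]) : Prop :=
  exists2 c : R, 0 < c & forall u w, T (u, w) -> c * sq u <= sq (w - g *: u).

Lemma SA_lin M T a u w v z : SA M T -> T (u, w) -> T (v, z) ->
  T (a *: u + v, a *: w + z).
Proof.
move=> [[[M0 lM] _] TM sT mT] h1 h2.
have [? ?] := TM _ _ h1; have [? ?] := TM _ _ h2.
apply: mT; [exact: lM|exact: lM|] => u' w' h.
by rewrite !ipDr !ipZr (sT _ _ _ _ h h1) (sT _ _ _ _ h h2).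
Qed.

Lemma SA_0 M T : SA M T -> T (0, 0).
Proof.
by move=> [[[M0 lM] _] TM sT mT]; apply: mT => // u w _; rewrite !ip0r.
Qed.

Lemma SA_Z M T a u w : SA M T -> T (u, w) -> T (a *: u, a *: w).
Proof.
by move=> h1 h2; have := SA_lin a h1 h2 (SA_0 h1); rewrite !addr0.
Qed.

Lemma SA_D M T u w v z : SA M T -> T (u, w) -> T (v, z) -> T (u + v, w + z).
Proof.
by move=> h0 h1 h2; have := SA_lin 1 h0 h1 h2; rewrite !scale1r.
Qed.

Lemma SA_B M T u w v z : SA M T -> T (u, w) -> T (v, z) -> T (u - v, w - z).
Proof.
by move=> h0 h1 h2; have := SA_lin (-1) h0 h2 h1; rewrite !scaleN1r addrC (addrC _ w).
Qed.

(** An adjoint is closed: symmetry with a fixed element of the graph passes to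
    limits. *)
Lemma SA_closed M T u w : SA M T ->
  (forall e : R, 0 < e ->
     exists u' w', [/\ T (u', w'), sq (u' - u) < e & sq (w' - w) < e]) ->
  T (u, w).
Proof.
move=> h h'; have [[_ cM] TM sT mT] := h; apply: mT.
- apply: cM => e /h'[u' [w' [Tu hu hw]]]; exists u' => //; exact: (TM _ _ Tu).1.
- apply: cM => e /h'[u' [w' [Tu hu hw]]]; exists w' => //; exact: (TM _ _ Tu).2.
have key v z : T (v, z) -> re z u = re v w.
  move=> Tv; apply/eqP; rewrite -subr_eq0 -sqrf_eq0 eq_le sqr_ge0 andbT.
  apply: le0_of_le_eps => e e0.
  have s0 : 0 < 2 * (1 + sq v + sq z).
    by have := sq_ge0 ip v; have := sq_ge0 ip z; lra.
  have d0 : 0 < e / (2 * (1 + sq v + sq z)) by rewrite divr_gt0.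
  have [u' [w' [Tu hu hw]]] := h' _ d0; move: hu hw d0.
  set d := e / _ => hu hw d0.
  have de : d * (2 * (1 + sq v + sq z)) = e by rewrite /d divfK // gt_eqF.
  have -> : re z u - re v w = re (w' - w) v - re (u' - u) z.
    rewrite !reE (reC ip w' v) (reC ip u' z) (reC ip u) (reC ip w).
    have : re z u' = re v w' by rewrite /re (sT _ _ _ _ Tv Tu).
    lra.
  have h1 := cauchy_schwarz ip (w' - w) v.
  have h2 := cauchy_schwarz ip (u' - u) z.
  have := sqr_ge0 (re (w' - w) v + re (u' - u) z).
  have := sq_ge0 ip v; have := sq_ge0 ip z.
  have := sq_ge0 ip (u' - u); have := sq_ge0 ip (w' - w); nra.
move=> v z Tv; apply: ip_eq; first exact: key.
exact: key (SA_Z 'i h Tv).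
Qed.

(** The range of [T - g] is closed by the lower bound, and a vector orthogonal
    to it is an eigenvector for the conjugate of [g]. *)
Lemma SA_onto M T g f : SA M T -> bounded_below T g ->
  (forall u, T (u, Num.conj g *: u) -> u = 0) -> M f ->
  exists u, T (u, f + g *: u).
Proof.
move=> h [c c0 hc] inj Mf; have [[sM cM] TM sT mT] := h.
pose V := [set v | exists u w, T (u, w) /\ v = w - g *: u].
have sV : subspace V.
  split; first by exists 0, 0; rewrite scaler0 subr0; split => //; exact: SA_0 h.
  move=> a _ _ [u [w [Tu ->]]] [v [z [Tv ->]]].
  exists (a *: u + v), (a *: w + z); split; first exact: SA_lin h _ _.
  by rewrite scalerBr scalerDr opprD addrACA !scalerA (mulrC a).
have VM v : V v -> M v.
  by move=> [u [w [/TM[? ?] ->]]]; apply: subB => //; apply: subZ.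
have [p [ap hp]] := projection f sV.
have Mp : M p by apply: cM => e /ap[v /VM Mv ?]; exists v.
have /inj /eqP : T (f - p, Num.conj g *: (f - p)).
  apply: mT; [exact: subB|by apply: subZ => //; exact: subB|].
  move=> u w Tu; rewrite ipZr.
  apply/eqP; rewrite -subr_eq0 (_ : Num.conj _ = g); last exact: conjcK.
  rewrite -ipZl -ipBl ipC hp ?rmorph0 //; by exists u, w.
rewrite subr_eq0 => /eqP fp; rewrite -fp in ap.
pose F (d : R) := [set u | exists w, T (u, w) /\ sq (w - g *: u - f) < d].
have [|||l hl] := complete_family ipn (F := F).
- by move=> d /ap[_ [u [w [Tu ->]]] hu]; exists u, w.
- by move=> d d' _ dd u [w [Tu hu]]; exists w; split => //; lra.
- move=> e e0; exists (c * e / 4); first by rewrite divr_gt0 // mulr_gt0.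
  move=> u v [w [Tu hu]] [z [Tv hv]].
  have := hc _ _ (SA_B h Tu Tv).
  have := sqD_le ip (w - g *: u - f) (- (z - g *: v - f)).
  rewrite sqN (_ : w - g *: u - f - _ = w - z - g *: (u - v)).
    by rewrite -(ltr_pM2l c0); lra.
  by rewrite [- (_ - f)]opprB addrA subrK scalerBr !opprD !opprK addrACA.
exists l; apply: SA_closed h _ => e e0.
pose n := complex.Re g ^+ 2 + complex.Im g ^+ 2.
have n0 : 0 <= n by rewrite addr_ge0 ?sqr_ge0.
have n1 : 0 < 4 * (1 + n) by lra.
have d0 : 0 < e / (4 * (1 + n)) by rewrite divr_gt0.
have [u [w [Tu hu]] hul] := hl _ _ d0 d0.
move: d0 hu hul; set d := e / _ => d0 hu hul.
have de : d * (4 * (1 + n)) = e by rewrite /d divfK // gt_eqF.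
exists u, w; split => //; first by nra.
rewrite (_ : w - _ = (w - g *: u - f) + g *: (u - l)).
  apply: le_lt_trans (sqD_le _ _ _) _.
  by rewrite sqZ -/n; have := sq_ge0 ip (u - l); nra.
rewrite scalerBr opprD [LHS]addrA [RHS]addrA; congr (_ + _).
by rewrite addrAC subrK.
Qed.

Lemma SA_real M T u w : SA M T -> T (u, w) -> complex.Im (ip w u) = 0.
Proof.
move=> [_ _ sT _] h; have e := sT _ _ _ _ h h.
have := congr1 (@complex.Im R) (ipC ip w u); rewrite cImJ -e; lra.
Qed.

(** The cross term is the real part of an imaginary multiple of [ip w u], which is
    real. *)
Lemma SA_nonreal M T (b : R) u w : SA M T -> T (u, w) ->
  sq (w - (0 +i* b) *: u) = sq w + b ^+ 2 * sq u.
Proof.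
move=> h Tu; rewrite -[in RHS](_ : sq (- ((0 +i* b) *: u)) = b ^+ 2 * sq u).
  rewrite /sq (reDl ip w) !(reDr ip w) (reC ip (- _) w).
  suff -> : re w (- ((0 +i* b) *: u)) = 0 by rewrite /sq; ring.
  by rewrite reNr /re ipZr cReM cReJ cImJ (SA_real h Tu) /=; ring.
by rewrite sqN sqZ /= expr0n add0r.
Qed.

Lemma SA_eig_real M T e g : SA M T -> T (e, g *: e) -> e != 0 ->
  complex.Im g = 0.
Proof.
move=> h Te e0; have := SA_real h Te; rewrite ipZl ipuu cImM /= mulr0 add0r.
move/eqP; rewrite mulf_eq0 => /orP[/eqP //|/eqP/sq_eq0 e1].
by rewrite e1 eqxx in e0.
Qed.

(** The complement of a set of eigenvectors reduces [T]. The
    orthogonal projection onto it may fail to preserve the domain, so that the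
    restriction contains its adjoint is deduced instead from the resolvents at
    ['i] and [- 'i], which map the complement to itself. *)
Lemma SA_restrict M T (E : set X) : SA M T ->
  (forall e, E e -> exists g, T (e, g *: e)) ->
  SA (M `&` ortho E) (restrict (M `&` ortho E) T).
Proof.
move=> h hE; have [[sM cM] TM sT mT] := h.
set M' := M `&` _; have cM' : closed_subspace ip M'.
  have [sO cO] := ortho_closed ip E; split; first split.
  - by split; [case: sM|case: sO].
  - by move=> a u v [? ?] [? ?]; split; [apply: sM.2|apply: sO.2].
  - move=> p hp; split; [apply: cM|apply: cO] => e /hp[v [? ?] ?];
    by exists v.
(* the resolvent of [T] at a nonreal point maps [M'] to itself *)
have onto (b : R) f : b != 0 -> M' f ->
    exists u, restrict M' T (u, f + (0 +i* b) *: u).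
  move=> b0 [Mf Of]; have b2 : 0 < b ^+ 2 by rewrite exprn_even_gt0.
  have [||u Tu] := @SA_onto M T (0 +i* b) f h _ _ Mf.
  - exists (b ^+ 2) => // u w Tu; rewrite (SA_nonreal _ h Tu).
    by have := sq_ge0 ip w; lra.
  - move=> u; rewrite (_ : Num.conj _ = 0 +i* (- b)) // => Tu.
    apply: (@sq_eq0 _ _ ip); have := SA_nonreal (- b) h Tu.
    rewrite subrr sq0 sqrrN => e; apply/eqP.
    have := sq_ge0 ip ((0 +i* - b) *: u); have := sq_ge0 ip u.
    rewrite eq_le => ? ?; apply/andP; split => //.
    by rewrite -(ler_pM2l b2); lra.
  have [Mu Mw] := TM _ _ Tu.
  have Ou : ortho E u.
    move=> e Ee; have [->|e0] := eqVneq e 0; first exact: ip0r.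
    have [g Te] := hE _ Ee; have gr := SA_eig_real h Te e0.
    have := sT _ _ _ _ Tu Te; rewrite ipDl Of // ipZl ipZr add0r.
    move/eqP; rewrite -subr_eq0 -mulrBl mulf_eq0 => /orP[|/eqP //].
    rewrite subr_eq0 => /eqP /(congr1 (@complex.Im R)); rewrite cImJ gr oppr0.
    by move=> /= b1; rewrite b1 eqxx in b0.
  exists u; split => //; split => //.
  by move=> e Ee; rewrite ipDl Of // ipZl Ou // mulr0 addr0.
split => //.
- by move=> u w [].
- by move=> u w v z [? ? ?] [? ? ?]; exact: sT.
move=> v z M'v M'z hvz.
have [sM' _] := cM'.
have [||v' Tv'] := onto 1 (z - (0 +i* 1) *: v); first exact: oner_neq0.
  by apply: subB => //; apply: subZ.
set z' := _ + _ in Tv'.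
have [M'v' M'z' _] := Tv'.
have ed : z - z' = (0 +i* 1) *: (v - v').
  by rewrite /z' opprD opprB addrA addrCA subrr addr0 scalerBr.
have [||u Tu] := onto (-1) (v - v'); [by rewrite oppr_eq0 oner_neq0| |].
  exact: subB.
have e0 : v - v' = 0.
  apply: (@sq_eq0 _ _ ip); apply: complexI; rewrite -ipuu.
  have [M'u _ Tu'] := Tu; have [_ _ Tv''] := Tv'.
  have e1 := hvz _ _ Tu; have e2 := sT _ _ _ _ Tu' Tv''.
  set w := _ + _ in Tu Tu' e1 e2.
  have e3 : ip w (v - v') = ip u (z - z') by rewrite !ipBr e1 e2.
  move: e3; rewrite ed ipDl ipZl ipZr /=.
  rewrite (_ : Num.conj _ = 0 +i* -1) //.
  by rewrite -[X in _ = X]add0r => /addIr.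
have ev : v = v' by apply/eqP; rewrite -subr_eq0 e0.
have ez : z = z' by apply/eqP; rewrite -subr_eq0 ed e0 scaler0.
by rewrite ev ez; case: Tv'.
Qed.

End Relations.

(** * From lower bounds of T - k to bounds of the quadratic form *)

Section SpectralBounds.
Variables (R : realType) (X : completeNormedModType R[i]).
Variable ip : {dot X for Num.conj}.
Local Notation subspace := Defs.subspace.
Local Notation restrict := Defs.restrict.
Local Notation ortho := (Defs.ortho ip).
Local Notation re := (re ip).
Local Notation sq := (sq ip).
Local Notation adh := (adh ip).
Local Notation SA := (self_adjoint_in ip).
Local Notation bounded_below := (bounded_below ip).
Implicit Types (T : set (X * X)) (M : set X).

Hypothesis ipn : inner_product_compatible ip.

Lemma bounded_below_inj T g : bounded_below T g ->
  forall u, T (u, g *: u) -> u = 0.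
Proof.
move=> [c c0 hc] u /hc; rewrite subrr sq0 => h; apply: (@sq_eq0 _ _ ip).
by apply/eqP; rewrite eq_le sq_ge0 andbT -(pmulr_rle0 _ c0).
Qed.

Lemma SA_onto_real M T (k : R) f : SA M T -> bounded_below T k%:C -> M f ->
  exists u, T (u, f + k%:C *: u).
Proof.
move=> h hb; apply: (SA_onto ipn h hb) => u.
by rewrite (_ : Num.conj _ = k%:C); [exact: bounded_below_inj|exact: conjc_real].
Qed.

Definition shift_inverse (k : R) T : set (X * X) :=
  [set fu | T (fu.2, fu.1 + k%:C *: fu.2)].

Lemma SA_shift_inverse k M T : SA M T -> SA M (shift_inverse k T).
Proof.
move=> h; have [[sM cM] TM sT mT] := h.
have conjk : Num.conj k%:C = k%:C by exact: conjc_real.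
split => //.
- move=> f u /TM /= [Mu Mw]; split => //.
  by rewrite -[f](addrK (k%:C *: u)); apply: subB => //; apply: subZ.
- move=> f u f' u' /= h1 h2; have /= := sT _ _ _ _ h1 h2.
  by rewrite ipDl ipDr ipZl ipZr conjk => /addIr.
- move=> v z Mv Mz hvz; apply: mT => //=.
    by apply: subD => //; apply: subZ.
  move=> u w Tu; have := hvz (w - k%:C *: u) u.
  rewrite /shift_inverse /= subrK => /(_ Tu).
  by rewrite ipBl ipDr ipZl ipZr conjk => ->; rewrite subrK.
Qed.

(** Spectral mapping: [(T - l)^-1 - m = - m (T - l - m^-1) (T - l)^-1]. *)
Lemma bounded_below_shift_inverse (l m : R) T : m != 0 ->
  bounded_below T (l + m^-1)%:C -> bounded_below (shift_inverse l T) m%:C.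
Proof.
move=> m0 [c c0 hc]; have m2 : 0 < m ^+ 2 by rewrite exprn_even_gt0.
pose K := 2 + 2 * m^-1 ^+ 2 / c.
have K0 : 0 < K.
  by rewrite ltr_wpDr // divr_ge0 ?(ltW c0) // mulr_ge0 ?sqr_ge0.
exists (m ^+ 2 / K) => [|f v /= /hc]; first exact: divr_gt0.
pose x := f - m^-1%:C *: v.
have -> : f + l%:C *: v - (l + m^-1)%:C *: v = x.
  by rewrite rmorphD scalerDl opprD addrA addrK.
have -> : v - m%:C *: f = (- m)%:C *: x.
  rewrite scalerBr scalerA -rmorphM mulNr divff // rmorphN rmorph1 scaleN1r.
  by rewrite opprK addrC rmorphN scaleNr.
rewrite sqZ /= expr0n addr0 sqrrN => hx.
have : sq f <= K * sq x.
  rewrite -[f](subrK (m^-1%:C *: v)) -/x; apply: le_trans (sqD_le _ _ _) _.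
  have -> : K * sq x = 2 * sq x + 2 * (m^-1 ^+ 2 * (sq x / c)) by rewrite /K; ring.
  rewrite sqZ /= expr0n addr0 lerD2l ler_pM2l // ler_wpM2l ?sqr_ge0 //.
  by rewrite ler_pdivlMr // mulrC.
by move=> hf; rewrite -mulrA ler_pM2l // mulrC ler_pdivrMr // mulrC.
Qed.

Definition neg_graph T : set (X * X) := [set uw | T (uw.1, - uw.2)].

Lemma SA_neg M T : SA M T -> SA M (neg_graph T).
Proof.
move=> h; have [[sM cM] TM sT mT] := h.
have MN u : M (- u) -> M u by move=> ?; rewrite -[u]opprK -scaleN1r; apply: subZ.
split => //.
- by move=> u w /TM /= [? ?]; split => //; exact: MN.
- move=> u w v z /= h1 h2; have /= := sT _ _ _ _ h1 h2.
  by rewrite ipNl ipNr => /oppr_inj.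
- move=> v z Mv Mz hvz; apply: mT => //=; first by apply: MN; rewrite opprK.
  move=> u w Tu; rewrite ipNr -(hvz u (- w)) ?ipNl ?opprK //.
  by rewrite /neg_graph /= opprK.
Qed.

Lemma bounded_below_neg T (k : R) : bounded_below T k%:C ->
  bounded_below (neg_graph T) (- k)%:C.
Proof.
move=> [c c0 hc]; exists c => // u w /hc /= h; apply: le_trans h _.
by rewrite -sqN opprB rmorphN scaleNr !opprK addrC.
Qed.

(** Let [s <= 0] be the best lower bound of the form of the bounded operator
    [T]. If [s < 0], then [P = T - s] is a nonnegative form, and positivity at
    [f - t P f] gives [(P f, f) >= |P f|^2 / B]. Since [P] is bounded below,
    the bound [s] can be improved. *)
Lemma nonneg_bounded M T C : SA M T -> (forall f, M f -> exists u, T (f, u)) ->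
  0 <= C -> (forall f u, T (f, u) -> sq u <= C * sq f) ->
  (forall m : R, m < 0 -> bounded_below T m%:C) ->
  forall f u, T (f, u) -> 0 <= re u f.
Proof.
move=> h tot C0 hC hb; have [[sM _] TM sT _] := h.
pose E : set R := [set m | m <= 0 /\ forall f u, T (f, u) -> m * sq f <= re u f].
have E0 : has_sup E.
  split; last by exists 0 => m [].
  exists (- (C + 1)); split; first by lra.
  move=> f u Tf; have := hC _ _ Tf; have := re_le ip u (- f).
  by have := sq_ge0 ip f; rewrite reNr sqN; nra.
have sE : E (sup E).
  split; first by apply: ge_sup; [exact: E0.1|move=> m []].
  move=> f u Tf; have [f0|f0] := eqVneq (sq f) 0.
    by rewrite f0 (sq_eq0 f0) re0r mulr0.
  have fp : 0 < sq f by rewrite lt_def f0 sq_ge0.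
  rewrite -ler_pdivlMr //; apply: ge_sup; first exact: E0.1.
  by move=> m [_ hm]; rewrite ler_pdivlMr //; exact: hm.
move: sE; set s := sup E => -[s0 hs].
suff s0' : s = 0 by move=> f u /hs; rewrite s0' mul0r.
apply/eqP/negPn/negP => sn0; have {sn0} sn : s < 0 by rewrite lt_def eq_sym sn0.
have [c c0 hc] := hb _ sn.
pose B := C + s ^+ 2 + 1.
have B0 : 0 < B by rewrite /B; have := sqr_ge0 s; lra.
(* [B] bounds the form of [P = T - s] by [(P p, p) <= B |p|^2]; the choice
   [t = 1 / B] minimizes [- 2 t + t^2 B] *)
have better f u : T (f, u) -> (s + c / B) * sq f <= re u f.
  move=> Tf; have [Mf Mu] := TM _ _ Tf.
  pose p := u - s%:C *: f.
  have Mp : M p by apply: subB => //; apply: subZ.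
  have [u' Tp] := tot _ Mp.
  pose p' := u' - s%:C *: p.
  pose t := B^-1.
  have tB : t * B = 1 by rewrite mulVf // gt_eqF.
  have t0 : 0 < t by rewrite invr_gt0.
  have := hs _ _ (SA_B h Tf (SA_Z t%:C h Tp)).
  have hp'p : re p' p <= B * sq p.
    have := re_le ip u' p; rewrite reDl reNl reZl -/(sq p).
    have := hC _ _ Tp; have := sq_ge0 ip p; rewrite /B.
    have := sqr_ge0 (s + 1); nra.
  have hp'f : re p' f = sq p.
    by rewrite reDl reNl reZl /re (sT _ _ _ _ Tp Tf) -/(re p u) /sq
      {3}/p reDr reNr reZr.
  have hcf := hc _ _ Tf; rewrite -/p in hcf.
  rewrite sqBZ reBZ => hh.
  have epf : re p f = re u f - s * sq f by rewrite reDl reNl reZl.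
  have ep'p : re p' p = re u' p - s * sq p by rewrite reDl reNl reZl.
  have ep'f : re p' f = re u' f - s * re p f by rewrite reDl reNl reZl.
  have epp : sq p = re u p - s * re p f.
    by rewrite {1}/sq {1}/p reDl reNl reZl (reC ip f).
  have {}hh : 0 <= re p f - 2 * t * sq p + t ^+ 2 * re p' p.
    rewrite (reC ip f p) in hh; rewrite hp'f in ep'f; nra.
  have h2 : t ^+ 2 * re p' p <= t * sq p.
    have -> : t * sq p = t ^+ 2 * (B * sq p) by rewrite expr2 -mulrA (mulrA _ B) tB mul1r.
    by rewrite ler_pM2l // exprn_gt0.
  have h3 : t * sq p <= re p f by lra.
  have h4 : t * (c * sq f) <= t * sq p by rewrite ler_pM2l.
  have -> : c / B = c * t by [].
  rewrite epf in h3; nra.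
pose m := Num.min 0 (s + c / B).
have Em : E m.
  split; first by rewrite /m ge_min lexx.
  move=> f u Tf; apply: le_trans (better _ _ Tf).
  by apply: ler_wpM2r; rewrite ?sq_ge0 // /m ge_min lexx orbT.
have : m <= s by apply: sup_upper_bound.
rewrite /m ge_min; apply/negP; rewrite negb_or -!ltNge sn /=.
by rewrite ltrDl divr_gt0.
Qed.

(** For [l < k0] the resolvent [(T - l)^-1] is bounded, and it satisfies the
    hypotheses of [nonneg_bounded] by spectral mapping; so [T >= l]. *)
Lemma form_lower_bound M T (k0 : R) : SA M T ->
  (forall k : R, k < k0 -> bounded_below T k%:C) ->
  forall u w, T (u, w) -> k0 * sq u <= re w u.
Proof.
move=> h hb u w Tu; rewrite -subr_le0; apply: le0_of_le_eps => e e0.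
have s0 : 0 < 1 + sq u by have := sq_ge0 ip u; lra.
pose l := k0 - e / (1 + sq u).
have lk : l < k0 by rewrite /l; have := divr_gt0 e0 s0; lra.
have [c c0 hc] := hb _ lk.
have : 0 <= re u (w - l%:C *: u).
  apply: (@nonneg_bounded M (shift_inverse l T) c^-1) => //.
  - exact: SA_shift_inverse.
  - by move=> f Mf; exact: SA_onto_real h (hb _ lk) Mf.
  - by rewrite invr_ge0 ltW.
  - move=> f v Tv; have := hc _ _ Tv; rewrite /= addrK => hv.
    by rewrite -(ler_pM2l c0) mulrA divff ?gt_eqF // mul1r.
  - move=> m m0.
    have mi : m^-1 < 0 by rewrite invr_lt0.
    have km : l + m^-1 < k0 by move: mi lk; lra.
    exact: bounded_below_shift_inverse (ltr0_neq0 m0) (hb _ km).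
  - by rewrite /shift_inverse /= subrK.
rewrite reDr reNr reZr (reC ip u w) -/(sq u) => hl.
have : l * (1 + sq u) = k0 * (1 + sq u) - e by rewrite /l mulrBl divfK // gt_eqF.
lra.
Qed.

Lemma form_upper_bound M T (k0 : R) : SA M T ->
  (forall k : R, k0 < k -> bounded_below T k%:C) ->
  forall u w, T (u, w) -> re w u <= k0 * sq u.
Proof.
move=> h hb u w Tu.
have := @form_lower_bound M (neg_graph T) (- k0) (SA_neg h) _ u (- w).
rewrite reNl mulNr lerN2; apply; last by rewrite /neg_graph /= opprK.
by move=> k kk; rewrite -[k]opprK; apply: bounded_below_neg; apply: hb; lra.
Qed.

(** On the complement of the kernel of [T - m], the inverse [Q] of [T - m] is
    self-adjoint, and [Q - k] is bounded below for [|k| > 1 / eps]; hence the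
    form of [Q] is bounded by [1 / eps]. A self-adjoint operator with a bounded
    form is bounded, which is the claim about [T - m]. *)
Lemma isolated_gap M T (m eps : R) : SA M T -> 0 < eps ->
  (forall n : R, n != m -> `|n - m| < eps -> bounded_below T n%:C) ->
  exists2 c : R, 0 < c & forall u w, T (u, w) ->
    (forall e, T (e, m%:C *: e) -> ip u e = 0) -> c * sq u <= sq (w - m%:C *: u).
Proof.
move=> h e0 hb; have [[sM cM] TM sT mT] := h.
pose E : set X := [set e | T (e, m%:C *: e)].
have h' : SA (M `&` ortho E) (restrict (M `&` ortho E) T).
  by apply: SA_restrict => // e Ee; exists m%:C.
set M' := _ `&` _ in h'; set T' := restrict _ _ in h'.
have [[sM' cM'] TM' sT' mT'] := h'.
pose Q := shift_inverse m T'.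
have hQ : SA M' Q by exact: SA_shift_inverse.
have [_ QM sQ mQ] := hQ.
have ei : 0 < eps^-1 by rewrite invr_gt0.
have hbQ (k : R) : eps^-1 < `|k| -> bounded_below Q k%:C.
  move=> hk; have k0 : k != 0 by rewrite -normr_gt0; exact: lt_trans hk.
  apply: bounded_below_shift_inverse => //.
  have [||c c0 hc] := hb (m + k^-1).
  - by rewrite -subr_eq0 addrAC subrr add0r invr_eq0.
  - rewrite addrAC subrr add0r normfV.
    by rewrite -[eps]invrK ltf_pV2 // posrE normr_gt0.
  - by exists c => // u w [_ _]; exact: hc.
have lowQ f u : Q (f, u) -> - eps^-1 * sq f <= re u f.
  apply: form_lower_bound hQ _ _ _ => k hk; apply: hbQ.
  by rewrite ltr0_norm; lra.
have upQ f u : Q (f, u) -> re u f <= eps^-1 * sq f.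
  apply: form_upper_bound hQ _ _ _ => k hk; apply: hbQ.
  by rewrite gtr0_norm; lra.
pose D : set X := [set f | exists u, Q (f, u)].
have sD : subspace D.
  split; first by exists 0; exact: SA_0 hQ.
  move=> a f g [u Qf] [v Qg]; exists (a *: u + v); exact: SA_lin hQ Qf Qg.
(* the domain of [Q] is dense, [T - m] being injective on [M'] *)
have dD p : M' p -> adh D p.
  move=> M'p; have [q [aq hq]] := projection ipn p sD.
  have M'q : M' q.
    by apply: cM' => e /aq[v [u /QM[M'v _]] hv]; exists v.
  suff /eqP : p - q = 0 by rewrite subr_eq0 => /eqP->.
  have M'pq : M' (p - q) by exact: subB.
  have : Q (0, p - q).
    apply: mQ => //; first by case: sM'.
    by move=> f u Qf; rewrite ip0r ipC hq ?rmorph0 //; exists u.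
  rewrite /Q /shift_inverse /= add0r => -[_ _ Epq].
  apply: (@sq_eq0 _ _ ip); apply: complexI; rewrite -ipuu.
  by case: M'pq => _ /(_ _ Epq).
pose B := 2 * eps^-1.
have B0 : 0 < B by rewrite mulr_gt0.
have bnd f u : Q (f, u) -> sq u <= (2 * B ^+ 2 + 2 * eps^-1 ^+ 2) * sq f.
  move=> Qf; have [M'f M'u] := QM _ _ Qf.
  (* [p = (Q + 1 / eps) f], where [0 <= Q + 1 / eps <= B] as forms *)
  pose p := u - (- eps^-1)%:C *: f.
  have M'p : M' p by apply: subB => //; apply: subZ.
  have hp : sq p <= B ^+ 2 * sq f.
    rewrite -subr_le0; apply: le0_of_le_eps => e epos.
    have [g [k Qg] hg] := dD _ M'p _ epos.
    pose t := B^-1.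
    have tB : B * t = 1 by rewrite divff // gt_eqF.
    have := lowQ _ _ (SA_B hQ Qf (SA_Z t%:C hQ Qg)).
    rewrite sqBZ reBZ.
    have Qs : re k f = re g u by rewrite /re (sQ _ _ _ _ Qg Qf).
    have e1 : re p g = re u g + eps^-1 * re f g.
      by rewrite reDl reNl reZl mulNr opprK.
    have := upQ _ _ Qf; have := upQ _ _ Qg.
    have e2 : sq (g - p) = sq g - 2 * re p g + sq p.
      by rewrite sqB (reC ip g p).
    rewrite e2 in hg; rewrite Qs (reC ip g u) => h1 h2 h3.
    have h4 : 0 <= B * sq f - 2 * t * re p g + t ^+ 2 * (B * sq g).
      rewrite e1 /B; have := sqr_ge0 t; nra.
    have h5 : 0 <= B * (B * sq f - 2 * t * re p g + t ^+ 2 * (B * sq g)).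
      by rewrite mulr_ge0 // ltW.
    have e3 : B * (B * sq f - 2 * t * re p g + t ^+ 2 * (B * sq g)) =
      B ^+ 2 * sq f - 2 * (B * t) * re p g + (B * t) ^+ 2 * sq g by ring.
    rewrite e3 tB in h5; lra.
  rewrite -[u](subrK ((- eps^-1)%:C *: f)) -/p.
  apply: le_trans (sqD_le _ _ _) _; rewrite sqZ /= expr0n addr0 sqrrN; lra.
pose C := 2 * B ^+ 2 + 2 * eps^-1 ^+ 2.
have C0 : 0 < C by rewrite addr_gt0 // mulr_gt0 // exprn_gt0.
exists C^-1; first by rewrite invr_gt0.
move=> u w Tu Ou; have [Mu Mw] := TM _ _ Tu.
rewrite mulrC ler_pdivrMr // mulrC; apply: bnd.
rewrite /Q /shift_inverse /= subrK; split => //=; split => //.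
move=> e Ee; rewrite (sT _ _ _ _ Tu Ee) ipZr Ou //; exact: mulr0.
Qed.

End SpectralBounds.

(** * Finite codimension *)

Section FiniteCodim.
Variables (R : realType) (X : completeNormedModType R[i]).
Variable ip : {dot X for Num.conj}.
Local Notation ortho := (Defs.ortho ip).
Local Notation dim := Defs.dim.
Local Notation re := (re ip).
Local Notation sq := (sq ip).
Local Notation SA := (self_adjoint_in ip).
Local Notation bounded_below := (bounded_below ip).
Implicit Types (T : set (X * X)) (M : set X).

Hypothesis ipn : inner_product_compatible ip.

(** Fewer equations than unknowns. *)
Lemma lin_system (I : finType) (v : I -> X) (s : seq X) : (size s < #|I|)%N ->
  exists c : I -> R[i], (exists i, c i != 0) /\
    forall e, e \in s -> ip (\sum_i c i *: v i) e = 0.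
Proof.
move=> hs; pose A : 'M[R[i]]_(#|I|, size s) :=
  \matrix_(i, j) ip (v (enum_val i)) (nth 0 s j).
have : kermx A != 0.
  by rewrite -mxrank_eq0 mxrank_ker -lt0n subn_gt0 (leq_ltn_trans (rank_leq_col A)).
case/rowV0Pn => x /sub_kermxP xA x0.
exists (fun i => x 0 (enum_rank i)); split.
  have [i xi] : exists i, x 0 i != 0.
    apply/existsP; apply: contraNT x0; rewrite negb_exists => /forallP h.
    by apply/eqP/rowP => i; rewrite mxE; apply/eqP; move: (h i); rewrite negbK.
  by exists (enum_val i); rewrite enum_valK.
move=> e es; have js : (index e s < size s)%N by rewrite index_mem.
have := congr1 (fun B : 'M[R[i]]_(1, size s) => B 0 (Ordinal js)) xA.
rewrite !mxE => xe; rewrite ip_sum_l -[RHS]xe.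
rewrite (reindex_onto (@enum_val I I) enum_rank) => [|i _]; last exact: enum_rankK.
apply: eq_big => [i|i _]; first by rewrite enum_valK eqxx.
by rewrite ipZl enum_valK mxE /= nth_index.
Qed.

Lemma dim_leP (S : set X) (n : nat) :
  (forall m (v : 'I_m -> X), (forall i, S (v i)) -> lin_indep v -> (m <= n)%N) ->
  (dim S <= n%:R%:E)%E.
Proof.
move=> h; apply: ge_ereal_sup => _ [m [v [Sv lv]] <-].
by rewrite lee_fin ler_nat; exact: h Sv lv.
Qed.

(** A maximal independent family in [S] spans [S]. *)
Lemma dim_basis (S : set X) : (dim S < +oo)%E ->
  exists n (v : 'I_n -> X), [/\ forall i, S (v i), lin_indep v,
    dim S = (n%:R : R)%:E &
    forall e, S e -> exists c : 'I_n -> R[i], e = \sum_i c i *: v i].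
Proof.
pose N n := exists v : 'I_n -> X, (forall i, S (v i)) /\ lin_indep v.
have le_dim n : N n -> ((n%:R : R)%:E <= dim S)%E.
  by move=> Nn; apply: ereal_sup_ubound; exists n.
move=> fin; have N0 : N 0%N.
  have f0 : 'I_0 -> X by case.
  by exists f0; split=> [[]|c _ []].
have := le_dim _ N0; case E : (dim S) fin => [r| |] // _ r0.
have bnd n : `[< N n >] -> (n <= Num.truncn r)%N.
  move/asboolP/le_dim; rewrite E lee_fin => nr; by rewrite truncn_ge_nat.
have ex : exists n, `[< N n >] by exists 0%N; apply/asboolP.
case: (ex_maxnP ex bnd) => n /asboolP Nn hmax.
have [v [Sv lv]] := Nn; exists n, v; split => //.
  apply/eqP; rewrite eq_le -E le_dim // andbT; apply: dim_leP => m w Sw lw.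
  by apply: hmax; apply/asboolP; exists w.
move=> e Se; pose v' (i : 'I_n.+1) := if unlift ord0 i is Some j then v j else e.
have Sv' i : S (v' i) by rewrite /v'; case: unliftP.
have nl : ~ lin_indep v'.
  move=> l'; have := hmax n.+1; rewrite ltnn => h.
  suff : false by []; by apply: h; apply/asboolP; exists v'.
have sum_v' (c : 'I_n.+1 -> R[i]) :
    \sum_i c i *: v' i = c ord0 *: e + \sum_i c (lift ord0 i) *: v i.
  rewrite big_ord_recl {1}/v' unlift_none; congr (_ + _).
  by apply: eq_bigr => i _; rewrite /v' liftK.
have [c [c1 c2]] : exists c : 'I_n.+1 -> R[i],
    \sum_i c i *: v' i = 0 /\ ~ forall i, c i = 0.
  by apply: contrapT => h; apply: nl => c hc; apply: contrapT => h'; apply: h;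
     exists c; split => // h2; apply: h'.
rewrite sum_v' in c1; have c0 : c ord0 != 0.
  apply/negP => /eqP c0; apply: c2 => i; rewrite c0 scale0r add0r in c1.
  by case: (unliftP ord0 i) => [j ->|-> //]; exact: lv c1 j.
exists (fun i => - (c ord0)^-1 * c (lift ord0 i)).
move/eqP: c1; rewrite addr_eq0 => /eqP/(congr1 (fun x => (c ord0)^-1 *: x)).
rewrite scalerA mulVf // scale1r => ->.
rewrite scalerN -scaleNr scaler_sumr; apply: eq_bigr => i _.
by rewrite scalerA.
Qed.

Definition orth_list (u : X) (s : seq X) := forall e, e \in s -> ip u e = 0.

Lemma dim_list (S : set X) : (dim S < +oo)%E -> exists s : seq X,
  [/\ forall e, e \in s -> S e, dim S = ((size s)%:R : R)%:E &
      forall u, orth_list u s -> ortho S u].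
Proof.
move=> /dim_basis[n [v [Sv lv -> hv]]]; exists (map v (enum 'I_n)); split.
- by move=> e /mapP[i _ ->].
- by rewrite size_map size_enum_ord.
- move=> u hu e /hv[c ->]; rewrite ip_sum_r big1 // => i _.
  by rewrite ipZr hu ?mulr0 // map_f // mem_enum.
Qed.

Definition below_on_orth T (g : R[i]) (s : seq X) :=
  exists2 c : R, 0 < c &
    forall u w, T (u, w) -> orth_list u s -> c * sq u <= sq (w - g *: u).

(** The vectors of [s] are removed one at a time. Consider the vectors
    [x] of the domain that are orthogonal to the rest, with [(x, e) = 1]: if
    [(T - g) x] came arbitrarily close to 0, these [x] would form a Cauchy family,
    whose limit would be a nonzero vector of the kernel. *)
Lemma finite_codim_bounded_below M T g s : SA M T -> below_on_orth T g s ->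
  (forall u, T (u, g *: u) -> u = 0) -> bounded_below T g.
Proof.
move=> h; have lc : forall u w v z a, T (u, w) -> T (v, z) ->
    T (u - a *: v, w - a *: z).
  by move=> u w v z a Tu Tv; exact: SA_B h Tu (SA_Z a h Tv).
elim: s => [|e r IH] [c c0 hc] inj.
  by exists c => // u w Tu; apply: hc.
have hcons u : orth_list u r -> ip u e = 0 -> orth_list u (e :: r).
  by move=> h1 h2 x; rewrite inE => /orP[/eqP->|/h1].
apply: IH => //.
have [[f [wf [Tf [Of fe]]]]|no] :=
  pselect (exists f wf, T (f, wf) /\ orth_list f r /\ ip f e = 1); last first.
  exists c => // u w Tu Ou; apply: (hc _ _ Tu); apply: hcons => //.
  apply: contrapT => /eqP ue; apply: no.
  exists ((ip u e)^-1 *: u), ((ip u e)^-1 *: w); split; first exact: SA_Z h Tu.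
  by split; [move=> x xr; rewrite ipZl (Ou x xr) mulr0|rewrite ipZl mulVf].
pose F (d : R) : set X := [set x | exists w, [/\ T (x, w), orth_list x r,
   ip x e = 1 & sq (w - g *: x) < d]].
have [d d0 Fd] : exists2 d : R, 0 < d & forall x, ~ F d x.
  apply: contrapT => no.
  have [|||l hl] := complete_family ipn (F := F).
  - move=> d d0; apply: contrapT => Fd; apply: no; exists d => // x Fx.
    by apply: Fd; exists x.
  - by move=> d d' _ dd x [w [? ? ? ?]]; exists w; split => //; lra.
  - move=> eps e0; exists (c * eps / 4); first by rewrite divr_gt0 // mulr_gt0.
    move=> u v [w [Tu Ou ue hu]] [z [Tv Ov ve hv]].
    have := hc _ _ (SA_B h Tu Tv).
    have := sqD_le ip (w - g *: u) (- (z - g *: v)).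
    rewrite sqN (_ : w - g *: u - _ = w - z - g *: (u - v)); last first.
      by rewrite scalerBr !opprD !opprK addrACA.
    rewrite -(ltr_pM2l c0) => h1 h2.
    suff : orth_list (u - v) (e :: r) by move/h2; lra.
    apply: hcons; last by rewrite ipBl ue ve subrr.
    by move=> x xr; rewrite ipBl Ou // Ov // subrr.
  have l0 : l = 0.
    apply: inj; apply: SA_closed h _ => eps e0.
    pose n := complex.Re g ^+ 2 + complex.Im g ^+ 2.
    have n0 : 0 <= n by rewrite addr_ge0 ?sqr_ge0.
    have n1 : 0 < 4 * (1 + n) by lra.
    have d0 : 0 < eps / (4 * (1 + n)) by rewrite divr_gt0.
    have [u [w [Tu Ou ue hu]] hul] := hl _ _ d0 d0.
    move: d0 hu hul; set d := eps / _ => d0 hu hul.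
    have de : d * (4 * (1 + n)) = eps by rewrite /d divfK // gt_eqF.
    exists u, w; split => //; first by nra.
    rewrite (_ : w - _ = (w - g *: u) + g *: (u - l)).
      apply: le_lt_trans (sqD_le _ _ _) _.
      by rewrite sqZ -/n; have := sq_ge0 ip (u - l); nra.
    by rewrite scalerBr addrA subrK.
  have s0 : 0 < 1 + sq e by have := sq_ge0 ip e; lra.
  have d0 : 0 < (1 + sq e)^-1 by rewrite invr_gt0.
  have [u [w [_ _ ue _]]] := hl _ _ d0 d0; rewrite l0 subr0.
  rewrite -div1r ltr_pdivlMr // => hu.
  have := cauchy_schwarz ip u e; rewrite {1}/re ue /= expr1n.
  have := sq_ge0 ip u; lra.
pose F0 := sq (wf - g *: f).
have F00 : 0 <= F0 by exact: sq_ge0.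
have f0 : 0 <= sq f by exact: sq_ge0.
pose K := (4 / c + 4 * F0 / (c * d) + 2 * sq f / d).
have K0 : 0 < K.
  have : 0 < 4 / c by rewrite divr_gt0.
  have : 0 <= 4 * F0 / (c * d) by rewrite divr_ge0 // ?mulr_ge0 // ltW.
  have : 0 <= 2 * sq f / d by rewrite divr_ge0 // ?mulr_ge0 // ltW.
  rewrite /K; lra.
exists K^-1; first by rewrite invr_gt0.
move=> u w Tu Ou; set S := sq (w - _).
pose a := ip u e; pose n := complex.Re a ^+ 2 + complex.Im a ^+ 2.
have n0 : 0 <= n by rewrite addr_ge0 ?sqr_ge0.
have nS : d * n <= S.
  have [a0|a0] := eqVneq a 0.
    by rewrite /n a0 /= expr0n addr0 mulr0; exact: sq_ge0.
  have [nlt|] := ltP (sq (a^-1 *: w - g *: (a^-1 *: u))) d.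
    case: (Fd (a^-1 *: u)); exists (a^-1 *: w); split => //.
    - exact: SA_Z h Tu.
    - by move=> x xr; rewrite ipZl (Ou x xr) mulr0.
    - by rewrite ipZl mulVf.
  rewrite scalerA (mulrC g) -scalerA -scalerBr => hd.
  have -> : S = n * sq (a^-1 *: (w - g *: u)).
    by rewrite -[X in X * _]/(complex.Re a ^+ 2 + complex.Im a ^+ 2) -sqZ scalerA
      divff // scale1r.
  by rewrite mulrC ler_wpM2l.
have yS : c * sq (u - a *: f) <= 2 * S + 2 * (n * F0).
  have Ty := lc _ _ _ _ a Tu Tf.
  apply: le_trans (hc _ _ Ty _) _.
    apply: hcons; last by rewrite ipBl ipZl fe mulr1 subrr.
    by move=> x xr; rewrite ipBl ipZl Ou // Of // mulr0 subrr.
  have := sqD_le ip (w - g *: u) (- (a *: (wf - g *: f))).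
  rewrite sqN sqZ -/S -/n -/F0; apply: le_trans.
  rewrite le_eqVlt; apply/orP; left; apply/eqP; congr (sq _).
  rewrite !scalerBr !opprB !scalerA (mulrC a g) addrACA [RHS]addrACA.
  by congr (_ + _); exact: addrC.
have uS : sq u <= 2 * sq (u - a *: f) + 2 * (n * sq f).
  have := sqD_le ip (u - a *: f) (a *: f); rewrite subrK sqZ -/n; exact.
rewrite mulrC ler_pdivrMr // mulrC.
have e1 : K * S = 2 * (2 * S + 2 * (S / d * F0)) / c + 2 * (S / d * sq f).
  by rewrite /K; field; rewrite !gt_eqF.
have nd : n <= S / d by rewrite ler_pdivlMr // mulrC.
have y2 : sq (u - a *: f) <= (2 * S + 2 * (S / d * F0)) / c.
  rewrite ler_pdivlMr // mulrC; apply: le_trans yS _.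
  by rewrite lerD2l ler_pM2l // ler_wpM2r.
apply: le_trans uS _; rewrite e1 -mulrA; apply: lerD; first by rewrite ler_pM2l.
by rewrite ler_pM2l // ler_wpM2r.
Qed.
End FiniteCodim.

(** * Discrete spectrum *)

Section DiscreteSpectrum.
Variables (R : realType) (X : completeNormedModType R[i]).
Variable ip : {dot X for Num.conj}.
Local Notation subspace := Defs.subspace.
Local Notation restrict := Defs.restrict.
Local Notation ortho := (Defs.ortho ip).
Local Notation dim := Defs.dim.
Local Notation eigenspace := Defs.eigenspace.
Local Notation eigenvalue := Defs.eigenvalue.
Local Notation re := (re ip).
Local Notation sq := (sq ip).
Local Notation adh := (adh ip).
Local Notation SA := (self_adjoint_in ip).
Local Notation bounded_below := (bounded_below ip).
Implicit Types (T : set (X * X)) (M : set X).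

Hypothesis ipn : inner_product_compatible ip.

Local Notation below_on_orth := (below_on_orth ip).
Local Notation orth_list := (orth_list ip).

Definition sqnormc (a : R[i]) : R := complex.Re a ^+ 2 + complex.Im a ^+ 2.

Lemma sqnormc_ge0 a : 0 <= sqnormc a. Proof. by rewrite addr_ge0 ?sqr_ge0. Qed.

Lemma sqnormc_gt0 a : a != 0 -> 0 < sqnormc a.
Proof.
move=> a0; rewrite lt_def sqnormc_ge0 andbT; apply: contraNneq a0.
move/eqP; rewrite paddr_eq0 ?sqr_ge0 // !sqrf_eq0 => /andP[/eqP h1 /eqP h2].
by apply/eqP; rewrite [a]complexE h1 h2 mulr0 addr0.
Qed.

Lemma sqnormcJ a : sqnormc (Num.conj a) = sqnormc a.
Proof. by rewrite /sqnormc cReJ cImJ sqrrN. Qed.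

Lemma norm_lt_sqnormc (a : R[i]) (r : R) : 0 < r -> (`|a| < r%:C) = (sqnormc a < r ^+ 2).
Proof.
move=> r0; rewrite normc_def ltcR -/(sqnormc a) -[X in _ = (_ < X)]sqr_sqrtr ?sqr_ge0 //.
rewrite -[in RHS](sqr_sqrtr (sqnormc_ge0 a)) ltr_pXn2r ?nnegrE ?sqrtr_ge0 //.
by rewrite sqrtr_sqr ger0_norm // ltW.
Qed.

(** The constant in the definition of the resolvent set may be nonpositive,
    hence the constant [`|c| + 1]. *)
Lemma resolvent_bounded_below M T g : resolvent_set M T g -> bounded_below T g.
Proof.
move=> [[c hc] _]; pose C := `|c| + 1.
have C0 : 0 < C by rewrite ltr_wpDl.
have C2 : 0 < C ^+ 2 by rewrite exprn_gt0.
exists (C ^+ 2)^-1; first by rewrite invr_gt0.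
move=> u w Tu; rewrite mulrC ler_pdivrMr // mulrC -(norm_le ipn) ?(ltW C0) //.
apply: le_trans (hc _ _ Tu) _; apply: ler_wpM2r => //.
by rewrite lecR /C; have := ler_norm c; lra.
Qed.

Lemma bounded_below_resolvent M T g : SA M T ->
  bounded_below T g -> bounded_below T (Num.conj g) -> resolvent_set M T g.
Proof.
move=> h [c c0 hc] hj; split.
  exists (Num.sqrt c^-1) => u w Tu.
  rewrite (norm_le ipn) ?sqrtr_ge0 // sqr_sqrtr ?invr_ge0 ?(ltW c0) //.
  by rewrite -(ler_pM2l c0) mulrA divff ?gt_eqF // mul1r; exact: hc.
move=> f Mf; have [|u Tu] := SA_onto ipn h (ex_intro2 _ _ c c0 hc) _ Mf.
  exact: bounded_below_inj hj.
by exists u, (f + g *: u); rewrite addrK.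
Qed.

Lemma eigenspace_subspace M T g : SA M T -> subspace (eigenspace T g).
Proof.
move=> h; split; first by rewrite /Defs.eigenspace /= scaler0; exact: SA_0 h.
move=> a u v hu hv; rewrite /Defs.eigenspace /= scalerDr scalerA mulrC -scalerA.
exact: SA_lin h hu hv.
Qed.

Lemma eigenspace_closed M T g : SA M T -> adh (eigenspace T g) `<=` eigenspace T g.
Proof.
move=> h u hu; apply: (SA_closed h) => e e0.
have n1 : 0 < 1 + sqnormc g by have := sqnormc_ge0 g; lra.
have [v Tv hv] := hu _ (divr_gt0 e0 n1).
exists v, (g *: v); rewrite -scalerBr sqZ -/(sqnormc g).
move: hv; set d := e / _ => hv.
have de : d * (1 + sqnormc g) = e by rewrite /d divfK // gt_eqF.
have := sqnormc_ge0 g; have := sq_ge0 ip (v - u); split => //; nra.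
Qed.

(** Split [u] into its component [q] in the eigenspace of [k] and the rest [y].
    The two components of [(T - g) u] are orthogonal; the first one is
    [(k - g) q], and the second one is bounded below by
    [finite_codim_bounded_below] for [g = k], hence also for [g] near [k]. *)
Lemma eigenvalue_gap M T (k : R) s : SA M T -> below_on_orth T k%:C s ->
  exists2 r : R, 0 < r & forall g : R[i], g != k%:C -> sqnormc (k%:C - g) < r ->
    bounded_below T g.
Proof.
move=> h [c c0 hc]; have [[sM cM] TM sT mT] := h.
pose E := eigenspace T k%:C.
have h' : SA (M `&` ortho E) (restrict (M `&` ortho E) T).
  by apply: (SA_restrict ipn) => // e Ee; exists k%:C.
have [||c2 c20 hc2] := finite_codim_bounded_below ipn (s := s) (g := k%:C) h'.
- by exists c => // u w [_ _]; exact: hc.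
- move=> u [[Mu Ou] _ Tu]; apply: (@sq_eq0 _ _ ip); apply: complexI.
  by rewrite -ipuu Ou.
exists (c2 / 4); first by rewrite divr_gt0.
move=> g gk; set d := sqnormc _ => dr.
have d0 : 0 < d by rewrite /d sqnormc_gt0 // subr_eq0 eq_sym.
exists d => // u w Tu.
have [q [aq hq]] := projection ipn u (eigenspace_subspace k%:C h).
have Eq := eigenspace_closed h aq.
pose y := u - q; pose z := w - k%:C *: q.
have Ty : T (y, z) by exact: SA_B h Tu Eq.
have Oy : ortho E y by [].
have Oz : ortho E z.
  by move=> e Ee; rewrite (sT _ _ _ _ Ty Ee) ipZr Oy //; exact: mulr0.
have [My Mz] := TM _ _ Ty.
have := hc2 _ _ (And3 (conj My Oy) (conj Mz Oz) Ty).
have -> : w - g *: u = (z - g *: y) - (g - k%:C) *: q.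
  rewrite /z /y scalerBr scalerBl !opprB [RHS]addrAC.
  by rewrite (addrA (_ - _) (k%:C *: q)) subrK (addrA (w - _)) subrK.
have Ozy : ip (z - g *: y) q = 0 by rewrite ipBl ipZl Oz // Oy // mulr0 subrr.
have eu : sq u = sq y + sq q.
  rewrite -[u](subrK q) -/y -[q in y + q]opprK sqB sqN reNr.
  by rewrite /re Oy //= oppr0 mulr0 subr0.
rewrite [in X in _ -> X]sqB /re ipZr Ozy mulr0 /= mulr0 subr0 sqZ.
have -> : complex.Re (g - k%:C) ^+ 2 + complex.Im (g - k%:C) ^+ 2 = d.
  by rewrite -opprB cReN cImN !sqrrN.
rewrite eu => hz.
have := sqD_le ip (z - g *: y) ((g - k%:C) *: y).
rewrite (_ : _ + _ = z - k%:C *: y); last by rewrite scalerBl addrA subrK.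
rewrite sqZ.
have -> : complex.Re (g - k%:C) ^+ 2 + complex.Im (g - k%:C) ^+ 2 = d.
  by rewrite -opprB cReN cImN !sqrrN.
have := sq_ge0 ip y; nra.
Qed.

(** The eigenspace meets the complement of [s] only in 0, so its dimension is at
    most [size s]; [eigenvalue_gap] isolates [k]. *)
Lemma eigenvalue_discrete M T (k : R) s : SA M T -> below_on_orth T k%:C s ->
  eigenvalue T k%:C -> discrete_spectrum M T k%:C.
Proof.
move=> h hb ek; split; first split => //.
  have [r r0 hr] := eigenvalue_gap h hb.
  have specP g : sqnormc (k%:C - g) < r -> spectrum M T g -> g = k%:C.
    move=> gr sg; apply/eqP; apply: contrapT => /negP gk; apply: sg.
    apply: bounded_below_resolvent => //; first exact: hr.
    apply: hr; first by rewrite -[k%:C]conjc_real (inj_eq (can_inj (@conjcK R))).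
    by rewrite -[k%:C]conjc_real -rmorphB sqnormcJ.
  have ks : spectrum M T k%:C.
    move=> /resolvent_bounded_below/bounded_below_inj inj.
    by have [u u0 Tu] := ek; rewrite (inj _ Tu) eqxx in u0.
  split; first exact/mem_set.
  have s0 : 0 < Num.sqrt r by rewrite sqrtr_gt0.
  exists (ball (k%:C : (R[i] : numFieldType)) (Num.sqrt r)%:C).
    by apply: nbhsx_ballx; rewrite ltcR.
  apply/seteqP; split => [g [kg sg]|_ ->]; last first.
    by split => //; apply: ballxx; rewrite ltcR.
  apply: specP sg; move: kg; rewrite -ball_normE /= norm_lt_sqnormc //.
  by rewrite sqr_sqrtr // ltW.
have [c c0 hc] := hb.
apply: (@le_lt_trans _ _ ((size s)%:R)%:E); last by rewrite ltry.
apply: dim_leP => m v Sv lv; rewrite leqNgt; apply/negP => sm.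
rewrite -[m]card_ord in sm; have [a [[i ai] ha]] := lin_system ip v sm.
set u := \sum_i _ in ha.
have Tu : T (u, k%:C *: u).
  apply: (big_ind (eigenspace T k%:C)).
  - by case: (eigenspace_subspace k%:C h).
  - by move=> x y; apply: subD; exact: eigenspace_subspace h.
  - by move=> j _; apply: subZ => //; exact: eigenspace_subspace h.
have := hc _ _ Tu ha; rewrite subrr sq0 pmulr_rle0 // => u0.
have {}u0 : u = 0 by apply: (@sq_eq0 _ _ ip); apply/eqP; rewrite eq_le u0 sq_ge0.
by rewrite (lv _ u0) eqxx in ai.
Qed.

Definition discrete_eigenvectors M T : set X :=
  [set e | exists2 g, discrete_spectrum M T g & eigenspace T g e].

(** If [k] is an eigenvalue, it is discrete, so [T - k] is injective on the
    complement of the discrete eigenvectors in any case. *)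
Lemma bounded_below_discrete M T (k : R) s : SA M T -> below_on_orth T k%:C s ->
  let M' := M `&` ortho (discrete_eigenvectors M T) in
  bounded_below (restrict M' T) k%:C.
Proof.
move=> h hb M'.
have h' : SA M' (restrict M' T).
  by apply: (SA_restrict ipn) => // e [g _ Te]; exists g.
apply: (finite_codim_bounded_below ipn (s := s)) h' _ _.
  by have [c c0 hc] := hb; exists c => // u w [_ _]; exact: hc.
move=> u [[Mu Ou] _ /= Tu]; apply/eqP; apply: contrapT => /negP u0.
have : ip u u = 0.
  by apply: Ou; exists k%:C => //; apply: eigenvalue_discrete hb _ => //; exists u.
by rewrite ipuu => /complexI/sq_eq0/eqP; rewrite (negbTE u0).
Qed.

Lemma self_adjoint_SA T : self_adjoint ip T -> SA setT T.
Proof.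
move=> [_ hT]; split => //.
- move=> u w v z Tu; rewrite -{1}hT => /(_ _ _ Tu); exact.
- by move=> v z _ _ hv; rewrite -hT.
Qed.

Lemma finite_dim_union (D : set R[i]) T : finite_set D ->
  (forall g, D g -> (dim (eigenspace T g) < +oo)%E) ->
  exists s : seq X, (forall e, e \in s -> exists g, T (e, g *: e)) /\
    forall u, orth_list u s -> forall g e, D g -> eigenspace T g e -> ip u e = 0.
Proof.
move=> /finite_seqP[l ->] hfin.
suff [s [hs1 hs2]] : exists s : seq X, (forall e, e \in s -> exists g, T (e, g *: e)) /\
    forall u, orth_list u s -> forall g e, g \in l -> eigenspace T g e -> ip u e = 0.
  by exists s; split.
elim: l hfin => [|g l IH] hfin; first by exists [::]; split.
have [|s [hs1 hs2]] := IH.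
  by move=> g' g'l; apply: hfin; rewrite /= inE g'l orbT.
have [|s' [hs'1 _ hs'2]] := dim_list ip (S := eigenspace T g).
  by apply: hfin; rewrite /= inE eqxx.
exists (s' ++ s); split.
  by move=> e; rewrite mem_cat => /orP[/hs'1 He|/hs1 //]; exists g.
move=> u hu g' e; rewrite inE => /orP[/eqP->|g'l].
  by apply: hs'2 => x xs; apply: hu; rewrite mem_cat xs.
by apply: hs2 g'l => x xs; apply: hu; rewrite mem_cat xs orbT.
Qed.

Lemma isolated_bounded_below T (k : R) : SA setT T ->
  discrete_spectrum setT T k%:C ->
  exists2 eps : R, 0 < eps &
    forall n : R, n != k -> `|n - k| < eps -> bounded_below T n%:C.
Proof.
move=> h [[_ [_ [V nV hV]]] _].
have [_/pos_complex [r r0 ->] hr] := (nbhs_ballP _ _).1 nV.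
exists r => // n nk hn; apply: (@resolvent_bounded_below setT); apply: contrapT => sn.
have : (V `&` spectrum setT T) n%:C.
  split => //; apply: hr; rewrite -ball_normE /= norm_lt_sqnormc // -rmorphB /sqnormc /=.
  by rewrite expr0n addr0 -real_normK ?num_real // ltr_pXn2r ?nnegrE ?(ltW r0) // distrC.
by rewrite hV => /complexI /eqP; rewrite (negbTE nk).
Qed.

Lemma kernel_gap T (k : R) : SA setT T -> discrete_spectrum setT T k%:C ->
  exists2 c : R, 0 < c & forall u w, T (u, w) -> ortho (eigenspace T k%:C) u ->
    c * sq u <= sq (w - k%:C *: u).
Proof.
move=> h dk; have [eps e0 he] := isolated_bounded_below h dk.
by have [c c0 hc] := isolated_gap ipn h e0 he; exists c.
Qed.

(** The absolutely continuous spectrum and the eigenvalues embedded in it lie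
    above [om], so below [om] the spectrum is discrete. *)
Lemma essential_lower_bound T (om : R) :
  essential_spectrum_assumption ip T om -> forall k : R, k < om ->
  spectrum setT T k%:C -> discrete_spectrum setT T k%:C.
Proof.
move=> [he hac _ _] k kom sk; apply: contrapT => nd.
have : essential_spectrum setT T k%:C by [].
by rewrite he => -[/hac|[_ /hac]]; rewrite lecR leNgt kom.
Qed.

(** The finitely many discrete eigenvalues have finite multiplicities, so a
    finite list [s] of eigenvectors detects orthogonality to all of them; on
    their complement [T - k] is bounded below for each [k < om]. *)
Lemma finite_codim_form_bound T (om : R) : SA setT T ->
  essential_spectrum_assumption ip T om -> discrete_spectrum_assumption T ->
  exists s : seq X, (forall e, e \in s -> exists g, T (e, g *: e)) /\
    forall u w, T (u, w) -> orth_list u s -> om * sq u <= re w u.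
Proof.
move=> h hess hfin; have [_ _ sT _] := h.
have [|s [hs1 hs2]] := @finite_dim_union _ T hfin; first by move=> g [].
exists s; split => // u w Tu /hs2 Ou.
pose E := discrete_eigenvectors setT T.
have h' : SA (setT `&` ortho E) (restrict (setT `&` ortho E) T).
  by apply: (SA_restrict ipn) => // e [g _ Te]; exists g.
apply: (form_lower_bound ipn h'); last first.
  split=> //=; split => // e [g dg Te]; first exact: Ou Te.
  by rewrite (sT _ _ _ _ Tu Te) ipZr (Ou g) // mulr0.
move=> k kom; have [rk|sk] := pselect (resolvent_set setT T k%:C).
  have [c c0 hc] := resolvent_bounded_below rk.
  by exists c => // v z [_ _]; exact: hc.
have dk := essential_lower_bound hess kom sk.
have [c c0 hc] := kernel_gap h dk; exists c => // v z [[_ Ov] _ Tv].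
by apply: hc Tv _ => e Te; apply: Ov; exists k%:C.
Qed.

End DiscreteSpectrum.

(** * The operators A and K *)

Section ReducedOperators.
Variables (R : realType) (X : completeNormedModType R[i]).
Variable ip : {dot X for Num.conj}.
Local Notation restrict := Defs.restrict.
Local Notation ortho := (Defs.ortho ip).
Local Notation ker := Defs.ker.
Local Notation eigenspace := Defs.eigenspace.
Local Notation re := (re ip).
Local Notation sq := (sq ip).
Local Notation adh := (adh ip).
Local Notation SA := (self_adjoint_in ip).
Implicit Types (T : set (X * X)) (M : set X).

Hypothesis ipn : inner_product_compatible ip.

Local Notation below_on_orth := (below_on_orth ip).
Local Notation orth_list := (orth_list ip).

Lemma dense_adh V : dense V -> forall u : X, adh V u.
Proof.
move=> dV u e e0; have s0 : 0 < Num.sqrt e by rewrite sqrtr_gt0.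
have [||v [uv Vv]] := dV (ball u (Num.sqrt e)%:C).
- by exists u; apply: ballxx; rewrite ltcR.
- by apply: ball_open; rewrite ltcR.
exists v => //; move: uv; rewrite -ball_normE /= (norm_lt ipn) //.
by rewrite sqr_sqrtr ?(ltW e0) // sqBC.
Qed.

(** By symmetry [u] is orthogonal to the domain, which is dense. *)
Lemma self_adjoint_functional T u : self_adjoint ip T -> T (0, u) -> u = 0.
Proof.
move=> hT T0; have [_ _ sT _] := self_adjoint_SA hT; have [dT _] := hT.
apply: (@sq_eq0 _ _ ip); apply: complexI; rewrite -ipuu.
apply: (ip_adh0 (dense_adh dT u)) => v [w Tv].
by rewrite -(sT _ _ _ _ Tv T0) ip0r.
Qed.

Lemma form_gap (d : R) u v : 0 < d -> d * sq u <= re v u -> d ^+ 2 * sq u <= sq v.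
Proof.
move=> d0 h; have [u0|u0] := eqVneq (sq u) 0.
  by rewrite u0 mulr0 sq_ge0.
have up : 0 < sq u by rewrite lt_def u0 sq_ge0.
rewrite -(ler_pM2r up) -mulrA -expr2 -exprMn.
apply: le_trans (cauchy_schwarz ip v u); rewrite ler_pXn2r //.
  by rewrite nnegrE mulr_ge0 // ltW.
by rewrite nnegrE; apply: le_trans h; rewrite mulr_ge0 // ltW.
Qed.

Lemma form_below_on_orth T (a k : R) s :
  (forall u w, T (u, w) -> orth_list u s -> a * sq u <= re w u) ->
  k < a -> below_on_orth T k%:C s.
Proof.
move=> h ka; have d0 : 0 < a - k by lra.
exists ((a - k) ^+ 2); first by rewrite exprn_gt0.
move=> u w Tu /(h _ _ Tu) hu; apply: form_gap => //.
by rewrite reDl reNl reZl -/(sq u) mulrBl; lra.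
Qed.

Lemma form_above_on_orth T (a k : R) s :
  (forall u w, T (u, w) -> orth_list u s -> re w u <= a * sq u) ->
  a < k -> below_on_orth T k%:C s.
Proof.
move=> h ka; have d0 : 0 < k - a by lra.
exists ((k - a) ^+ 2); first by rewrite exprn_gt0.
move=> u w Tu /(h _ _ Tu) hu; rewrite -(sqN ip (w - _)); apply: form_gap => //.
by rewrite reNl reDl reNl reZl -/(sq u) mulrBl; lra.
Qed.

(** Symmetry of [(v, z)] with [T] on the complement of [s] only means that
    [T v - z] is a combination of [s]. One vector [e] is removed at a time: the
    defect of symmetry at a vector [f] of the domain with [(f, e) = 1] gives
    the coefficient of [e]. *)
Lemma adjoint_finite_codim T v z s : SA setT T ->
  (forall u w, T (u, w) -> orth_list u s -> ip w v = ip u z) ->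
  exists2 z', T (v, z') & forall x, orth_list x s -> ip x z' = ip x z.
Proof.
move=> h; have [_ _ _ mT] := h.
elim: s z => [|e r IH] z hz.
  by exists z => //; apply: mT => // u w Tu; apply: hz Tu _.
have hcons u : orth_list u r -> ip u e = 0 -> orth_list u (e :: r).
  by move=> h1 h2 x; rewrite inE => /orP[/eqP->|/h1].
have hr x : orth_list x (e :: r) -> orth_list x r.
  by move=> hx y yr; apply: hx; rewrite inE yr orbT.
have [[f [wf [Tf [Of fe]]]]|no] :=
  pselect (exists f wf, T (f, wf) /\ orth_list f r /\ ip f e = 1); last first.
  have [|z' Tz' hz'] := IH z; last by exists z' => // x /hr; exact: hz'.
  move=> u w Tu Ou; apply: (hz _ _ Tu); apply: hcons => //.
  apply: contrapT => /eqP ue; apply: no.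
  exists ((ip u e)^-1 *: u), ((ip u e)^-1 *: w); split; first exact: SA_Z h Tu.
  by split; [move=> x xr; rewrite ipZl (Ou x xr) mulr0|rewrite ipZl mulVf].
pose b := ip wf v - ip f z.
have [|z' Tz' hz'] := IH (z + Num.conj b *: e); last first.
  exists z' => // x hx; rewrite hz'; last exact: hr.
  by rewrite ipDr ipZr (hx e) ?inE ?eqxx // mulr0 addr0.
move=> u w Tu Ou; have := hz _ _ (SA_B h Tu (SA_Z (ip u e) h Tf)).
rewrite !ipBl !ipZl ipDr ipZr => hh.
rewrite (_ : Num.conj _ = b); last exact: conjcK.
have {}hh : ip w v - ip u e * ip wf v = ip u z - ip u e * ip f z.
  apply: hh; apply: hcons; last by rewrite ipBl ipZl fe mulr1 subrr.
  by move=> x xr; rewrite ipBl ipZl (Ou x xr) (Of x xr) mulr0 subrr.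
move/eqP: hh; rewrite subr_eq => /eqP ->; rewrite /b; ring.
Qed.

Variables (Lp Lm : set (X * X)) (omp omm : R).
Hypothesis saLp : self_adjoint ip Lp.
Hypothesis saLm : self_adjoint ip Lm.
Hypothesis essLp : essential_spectrum_assumption ip Lp omp.
Hypothesis essLm : essential_spectrum_assumption ip Lm omm.
Hypothesis disLp : discrete_spectrum_assumption Lp.
Hypothesis disLm : discrete_spectrum_assumption Lm.
Hypothesis omm0 : 0 < omm.

Local Notation H := (spaceH ip Lm).
Local Notation A := (opA ip Lp Lm).
Local Notation K := (opK ip Lm).

Let SAp : SA setT Lp := self_adjoint_SA saLp.
Let SAm : SA setT Lm := self_adjoint_SA saLm.

Lemma ker_eigenspace T : eigenspace T 0%:C = ker T.
Proof.
by apply/seteqP; split => u; rewrite /Defs.eigenspace /Defs.ker /= scale0r.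
Qed.

Lemma spaceH_closed : closed_subspace ip H. Proof. exact: ortho_closed. Qed.

Lemma spaceH_decomp x : exists h, H h /\ ortho H (x - h).
Proof.
have [h [ah hh]] := projection ipn x spaceH_closed.1.
by exists h; split => //; exact: spaceH_closed.2.
Qed.

(** The complement of [H] is the closure of the kernel of [Lm], which is closed. *)
Lemma ortho_spaceH_ker x : ortho H x -> Lm (x, 0).
Proof.
move=> hx; have [q [aq hq]] := projection ipn x (eigenspace_subspace 0%:C SAm).
have Nq := eigenspace_closed SAm aq.
have Hxq : H (x - q) by move=> v Nv; apply: hq; rewrite ker_eigenspace.
suff /eqP : x - q = 0.
  by rewrite subr_eq0 => /eqP ->; move: Nq; rewrite ker_eigenspace.
apply: (@sq_eq0 _ _ ip); apply: complexI; rewrite -ipuu ipBl hx //.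
by rewrite [ip q _]ipC hq // rmorph0 subrr.
Qed.

Lemma opKE u k : K (u, k) <-> [/\ H u, H k & Lm (k, u)].
Proof.
split => [[/= Hu [w Lw [/= Hk /ortho_spaceH_ker hw]]]|[Hu Hk Lk]].
  split => //; have := SA_B SAm Lw hw.
  by rewrite opprB addrCA subrr addr0 subr0.
split => //=; exists k => //=; split => //=.
by rewrite subrr => v _; exact: ip0l.
Qed.

Lemma SA_restrict_Lm : SA H (restrict H Lm).
Proof.
have := SA_restrict (E := ker Lm) ipn SAm; rewrite setTI; apply.
by move=> e Ne; exists 0; rewrite scale0r.
Qed.

Lemma SA_opK : SA H K.
Proof.
have := SA_shift_inverse 0 SA_restrict_Lm.
suff -> : shift_inverse 0 (restrict H Lm) = K by [].
apply/seteqP; split => -[u k]; rewrite /shift_inverse /= scale0r addr0.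
  by move=> [? ? ?]; apply/opKE.
by move/opKE => -[].
Qed.

(** As [omm > 0], the kernel of [Lm] is finite-dimensional and 0 is not an
    accumulation point of the spectrum; this makes [K] total. *)
Lemma zero_resolvent_or_discrete : resolvent_set setT Lm 0%:C \/ discrete_spectrum setT Lm 0%:C.
Proof.
have [?|s0] := pselect (resolvent_set setT Lm 0%:C); first by left.
by right; apply: essential_lower_bound essLm _ omm0 s0.
Qed.

(** [Lm] is bounded below on the complement of its kernel. *)
Lemma opK_total u : H u -> exists k, K (u, k).
Proof.
move=> Hu; have [|||k hk] := @SA_onto_real _ _ _ ipn H (restrict H Lm) 0 u.
- exact: SA_restrict_Lm.
- have [/(resolvent_bounded_below ipn)[c c0 hc]|d0] := zero_resolvent_or_discrete.
    by exists c => // v w [_ _]; exact: hc.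
  have [c c0 hc] := kernel_gap ipn SAm d0.
  by exists c => // v w [Hv _ Lv]; apply: hc Lv _; rewrite ker_eigenspace.
- exact: Hu.
by exists k; apply/opKE; move: hk; rewrite scale0r addr0 => -[].
Qed.

Lemma ker_list : exists s : seq X, (forall e, e \in s -> ker Lm e) /\
  forall u, orth_list u s -> H u.
Proof.
have [/(resolvent_bounded_below ipn)/bounded_below_inj inj|[_ d0]] := zero_resolvent_or_discrete.
  exists [::]; split => // u _ v Nv.
  by rewrite (inj v) ?ip0r // scale0r.
have [s [hs1 _ hs2]] := dim_list ip d0.
by rewrite ker_eigenspace in hs1 hs2; exists s; split => // u /hs2.
Qed.

Lemma opK_functional u k k' : K (u, k) -> K (u, k') -> k = k'.
Proof.
move=> /opKE[_ Hk Lk] /opKE[_ Hk' Lk']; apply/eqP; rewrite -subr_eq0; apply/eqP.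
apply: (@sq_eq0 _ _ ip); apply: complexI; rewrite -ipuu.
have := SA_B SAm Lk Lk'; rewrite subrr => N.
by have [sH _] := spaceH_closed; exact: (subB sH Hk Hk').
Qed.

Lemma opK_injective u u' k : K (u, k) -> K (u', k) -> u = u'.
Proof.
move=> /opKE[_ _ Lk] /opKE[_ _ Lk']; apply/eqP; rewrite -subr_eq0; apply/eqP.
by apply: (self_adjoint_functional saLm); have := SA_B SAm Lk Lk'; rewrite subrr.
Qed.

(** The compression of [Lp] to [H] contains its adjoint since [H] has finite codimension,
    even when the kernel of [Lm] is not contained in the domain of [Lp]. *)
Lemma SA_opA : SA H A.
Proof.
have [sH cH] := spaceH_closed; have [_ _ sp _] := SAp.
have OH w a x : ortho H (w - a) -> H x -> ip w x = ip a x.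
  by move=> h Hx; apply/eqP; rewrite -subr_eq0 -ipBl h.
split => //.
- by move=> u a [/= Hu [w _ [/= Ha _]]].
- move=> u a v b [/= Hu [w Lu [/= Ha Oa]]] [/= Hv [z Lv [/= Hb Ob]]].
  rewrite -(OH _ _ _ Oa Hv) (sp _ _ _ _ Lu Lv) [LHS]ipC [RHS]ipC.
  by rewrite (OH _ _ _ Ob Hu).
move=> v z Hv Hz hvz; have [s [hs1 hs2]] := ker_list.
have [|z' Lz' hz'] := @adjoint_finite_codim Lp v z s SAp.
  move=> u w Lu /hs2 Hu; have [a [Ha Oa]] := spaceH_decomp w.
  rewrite (OH _ _ _ Oa Hv); apply: hvz.
  by split => //=; exists w.
split => //=; exists z' => //=; split => //= x Hx.
rewrite ipC ipBr hz' ?subrr ?rmorph0 // => e es.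
by apply: Hx; exact: hs1.
Qed.

Lemma opA_functional u a a' : A (u, a) -> A (u, a') -> a = a'.
Proof.
move=> [/= Hu [w Lw [/= Ha Oa]]] [/= _ [w' Lw' [/= Ha' Oa']]].
have [sH cH] := spaceH_closed.
have ew : w = w'.
  apply/eqP; rewrite -subr_eq0; apply/eqP; apply: (self_adjoint_functional saLp).
  by have := SA_B SAp Lw Lw'; rewrite subrr.
apply/eqP; rewrite -subr_eq0; apply/eqP.
apply: (@sq_eq0 _ _ ip); apply: complexI; rewrite -ipuu.
have e : (w - a') - (w - a) = a - a' by rewrite opprB [LHS]addrC addrA subrK.
have Haa : H (a - a') := subB sH Ha Ha'.
rewrite -[X in ip X _]e ipBl (Oa _ Haa).
by move: (Oa' _ Haa); rewrite ew => ->; rewrite subrr.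
Qed.

(** [A] and [Lp] have the same form on [H]. *)
Lemma opA_form_bound u a : A (u, a) -> ortho (discrete_eigenvectors H A) u ->
  omp * sq u <= re a u.
Proof.
move=> Au Ou; have [s [_ hs]] := finite_codim_form_bound ipn SAp essLp disLp.
have hA : forall u a, A (u, a) -> orth_list u s -> omp * sq u <= re a u.
  move=> v b [/= Hv [w Lw [/= Hb Ob]]] /(hs _ _ Lw).
  suff -> : re w v = re b v by [].
  by rewrite /re -[w](subrK b) ipDl Ob // add0r.
have [[sH _] _ sA _] := SA_opA.
have h' : SA (H `&` ortho (discrete_eigenvectors H A))
    (restrict (H `&` ortho (discrete_eigenvectors H A)) A).
  by apply: (SA_restrict ipn SA_opA) => e [g _ Te]; exists g.
apply: (form_lower_bound ipn h').
  move=> k kom; apply: (bounded_below_discrete ipn SA_opA (s := s)).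
  exact: form_below_on_orth hA kom.
have [_ mA _ _] := SA_opA; have [Hu Ha] := mA _ _ Au.
split => //=; split => // e [g dg Te].
by rewrite (sA _ _ _ _ Au Te) ipZr Ou ?mulr0 //; exists g.
Qed.

(** If [u] is orthogonal to the list of eigenvectors of [Lm], then so is
    [k = K u]. From [omm |k|^2 <= (u, k)] and [0 <= |u - omm k|^2] follows
    [omm (k, u) <= |u|^2]. *)
Lemma opK_form_bound u k : K (u, k) -> ortho (discrete_eigenvectors H K) u ->
  re k u <= omm^-1 * sq u.
Proof.
move=> Ku Ou; have [s [hs1 hs]] := finite_codim_form_bound ipn SAm essLm disLm.
have [_ _ sm _] := SAm.
have hK : forall u k, K (u, k) -> orth_list u s -> re k u <= omm^-1 * sq u.
  move=> v l /opKE[Hv Hl Ll] Ov.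
  have := hs _ _ Ll; rewrite (reC ip v) => hl.
  have {}hl : omm * sq l <= re l v.
    apply: hl => e es; have [g Le] := hs1 _ es.
    have := sm _ _ _ _ Ll Le; rewrite (Ov e es) ipZr => /esym/eqP.
    rewrite mulf_eq0 => /orP[|/eqP //]; rewrite conjc_eq0 => /eqP g0.
    by apply: Hl; move: Le; rewrite g0 scale0r.
  have := sq_ge0 ip (v - omm%:C *: l); rewrite sqBZ (reC ip v l) => h.
  rewrite mulrC ler_pdivlMr // mulrC.
  have := ler_wpM2l (ltW omm0) hl; nra.
have [[sH _] _ sA _] := SA_opK.
have h' : SA (H `&` ortho (discrete_eigenvectors H K))
    (restrict (H `&` ortho (discrete_eigenvectors H K)) K).
  by apply: (SA_restrict ipn SA_opK) => e [g _ Te]; exists g.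
apply: (form_upper_bound ipn h').
  move=> c kom; apply: (bounded_below_discrete ipn SA_opK (s := s)).
  exact: form_above_on_orth hK kom.
have [_ mK _ _] := SA_opK; have [Hu Ha] := mK _ _ Ku.
split => //=; split => // e [g dg Te].
by rewrite (sA _ _ _ _ Ku Te) ipZr Ou ?mulr0 //; exists g.
Qed.

End ReducedOperators.

(** * Inverse square roots of polynomials *)

(** An inverse square root of [t - 'X] modulo ['X^n], by Hensel lifting from
    the constant [1 / sqrt t]. *)
Lemma poly_inv_sqrt (R : realType) (t : R) n : 0 < t ->
  exists p q : {poly R}, p * p * (t%:P - 'X) = 1 + 'X^n * q.
Proof.
move=> t0; case: n => [|n].
  by exists 0, (- 1); rewrite !mul0r expr0 mul1r subrr.
elim: n => [|n [p [q hpq]]].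
  pose c := (Num.sqrt t)^-1.
  exists c%:P, (- (c ^+ 2)%:P).
  have c2 : c ^+ 2 * t = 1.
    by rewrite exprVn sqr_sqrtr ?mulVf ?gt_eqF // ltW.
  by rewrite -!polyCM -expr2 mulrBr -polyCM c2 expr1 mulrN mulrC.
have p0 : p.[0] ^+ 2 * t = 1.
  have := congr1 (fun r : {poly R} => r.[0]) hpq.
  by rewrite !hornerE /= exprS mul0r mul0r addr0 expr2 subr0.
have p00 : p.[0] != 0.
  by apply: contra_eqN p0 => /eqP->; rewrite expr0n mul0r eq_sym oner_neq0.
have t00 : t != 0 by rewrite gt_eqF.
(* the coefficient that kills the constant term of the error [r] below *)
pose a := - q.[0] / (2 * p.[0] * t).
pose r := q + (a + a)%:P * p * (t%:P - 'X) + (a ^+ 2)%:P * 'X^(n.+1) * (t%:P - 'X).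
have : root r 0.
  rewrite /root /r !hornerE ?expr0n /= ?(mulr0, mul0r, addr0, subr0).
  by rewrite /a; apply/eqP; field; rewrite t00 p00.
move=> /factor_theorem[q']; rewrite subr0 => hr.
exists (p + a%:P * 'X^(n.+1)), q'.
have -> : (p + a%:P * 'X^(n.+1)) * (p + a%:P * 'X^(n.+1)) * (t%:P - 'X) =
  p * p * (t%:P - 'X) + 'X^(n.+1) * (r - q).
  rewrite /r polyCD (_ : (a ^+ 2)%:P = a%:P * a%:P); last by rewrite -polyCM expr2.
  move: 'X^(n.+1) (p) => y P; ring.
rewrite hpq hr (exprS _ n.+1); ring.
Qed.

(** * Suprema of natural numbers and sums over sets *)

Section Counting.
Variable R : realType.

(** Each supremum is attained: a set of naturals bounded by [M]. *)
Lemma sum_sup_le_nat (I : choiceType) (l : seq I) (P : I -> nat -> Prop) (M : nat) :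
  uniq l -> (forall g, P g 0%N) ->
  (forall n : I -> nat, (forall g, g \in l -> P g (n g)) ->
     (\sum_(g <- l) n g <= M)%N) ->
  (\sum_(g <- l) ereal_sup [set ((n%:R : R)%:E) | n in [set n | P g n]]
     <= (M%:R : R)%:E)%E.
Proof.
move=> ul P0 hM.
have att g : g \in l -> exists n, P g n /\
    (ereal_sup [set ((n%:R : R)%:E) | n in [set n | P g n]] <= (n%:R : R)%:E)%E.
  move=> gl; have bnd n : `[< P g n >] -> (n <= M)%N.
    move/asboolP => Pn; pose f h := if h == g then n else 0%N.
    have fg : f g = n by rewrite /f eqxx.
    have := hM f; rewrite (bigD1_seq g) //= fg => hn.
    apply: leq_trans (leq_addr _ _) (hn _) => h hl.
    by rewrite /f; case: eqP => [->|].
  have ex : exists n, `[< P g n >] by exists 0%N; apply/asboolP.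
  case: (ex_maxnP ex bnd) => n /asboolP Pn hmax; exists n; split => //.
  apply: ge_ereal_sup => _ [m Pm <-]; rewrite lee_fin ler_nat.
  by apply: hmax; apply/asboolP.
have [f hf] : exists f : I -> nat, forall g, g \in l -> P g (f g) /\
    (ereal_sup [set ((n%:R : R)%:E) | n in [set n | P g n]] <= ((f g)%:R : R)%:E)%E.
  exists (fun g => xget 0%N [set n | P g n /\
    (ereal_sup [set ((n%:R : R)%:E) | n in [set n | P g n]] <= (n%:R : R)%:E)%E]).
  by move=> g /att ex; have := xgetPex 0%N ex.
apply: (@le_trans _ _ (\sum_(g <- l) ((f g)%:R : R)%:E)%E).
  rewrite big_seq [X in (_ <= X)%E]big_seq; apply: lee_sum => g /hf[_]; exact.
rewrite sumEFin lee_fin -natr_sum ler_nat; apply: hM => g /hf[]; exact.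
Qed.

Lemma esumU (I : choiceType) (A B : set I) (a : I -> \bar R) :
  (forall i, 0 <= a i)%E -> A `&` B = set0 ->
  (\esum_(i in A) a i + \esum_(i in B) a i = \esum_(i in A `|` B) a i)%E.
Proof.
move=> a0 AB; rewrite (esumID A (A `|` B)) //.
congr (_ + _)%E; congr (esum _ _).
  by apply/seteqP; split => i /=; [split; [left|]|case].
apply/seteqP; split => i /=; last by case=> -[].
move=> Bi; split; first by right.
by move=> Ai; have : (A `&` B) i by []; rewrite AB.
Qed.

Lemma esum_le_seq (I : choiceType) (S : set I) (a : I -> \bar R) (M : \bar R) :
  (forall l : seq I, uniq l -> (forall i, i \in l -> S i) ->
     (\sum_(i <- l) a i <= M)%E) -> (\esum_(i in S) a i <= M)%E.
Proof.
move=> h; apply: ge_ereal_sup => _ [F [finF FS] <-].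
rewrite fsbig_finite //=; apply: h; first exact: finmap.fset_uniq.
by move=> i; rewrite in_fset_set // inE; exact: FS.
Qed.

End Counting.

(** * Root spaces of the pencil *)

Section Pencil.
Variables (R : realType) (X : completeNormedModType R[i]).
Variable ip : {dot X for Num.conj}.
Local Notation subspace := Defs.subspace.
Local Notation ortho := (Defs.ortho ip).
Local Notation dim := Defs.dim.
Local Notation re := (re ip).
Local Notation sq := (sq ip).
Local Notation SA := (self_adjoint_in ip).
Implicit Types (T : set (X * X)) (M : set X).

Local Notation orth_list := (orth_list ip).

Lemma lin_system_seq (J : eqType) (L : seq J) (v : J -> X) (s : seq X) :
  uniq L -> (size s < size L)%N ->
  exists c : J -> R[i], (exists2 x, x \in L & c x != 0) /\
    orth_list (\sum_(x <- L) c x *: v x) s.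
Proof.
case: L => [|x0 L'] //; set L := x0 :: L' => uL hs.
have [|c [[i ci] hc]] := @lin_system _ _ ip 'I_(size L) (fun i => v (nth x0 L i)) s.
  by rewrite card_ord.
pose c' x := if insub (index x L) is Some i then c i else 0.
have c'E (j : 'I_(size L)) : c' (nth x0 L j) = c j.
  by rewrite /c' index_uniq // valK.
exists c'; split; first by exists (nth x0 L i); rewrite ?mem_nth // c'E.
move=> e es; rewrite -(hc e es); congr (ip _ _).
rewrite (big_nth x0) big_mkord; apply: eq_bigr => j _.
by rewrite c'E.
Qed.

Lemma nat_family n (v : 'I_n -> X) : exists v' : nat -> X, (fun i : 'I_n => v' i) = v.
Proof.
exists (fun k => if insub k is Some i then v i else 0).
by apply/funext => i; rewrite valK.
Qed.

Variables (H : set X) (A K : set (X * X)).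
Hypotheses (hA : SA H A) (hK : SA H K).
Hypothesis K_total : forall u, H u -> exists k, K (u, k).
Hypothesis K_fun : forall u k k', K (u, k) -> K (u, k') -> k = k'.
Hypothesis K_inj : forall u u' k, K (u, k) -> K (u', k) -> u = u'.
Hypothesis A_fun : forall u k k', A (u, k) -> A (u, k') -> k = k'.

Local Notation T := (pencil A K).

(** The value of the operator with graph [G] at [u]; [bracket ip K u v] unfolds to
    [ip (gval K u) v]. *)
Definition gval (G : set (X * X)) (u : X) : X := xget 0 [set k | G (u, k)].

Lemma gval_in (G : set (X * X)) u k : G (u, k) -> G (u, gval G u).
Proof. by move=> Guk; have := @xgetPex _ 0 [set k | G (u, k)] (ex_intro _ k Guk). Qed.

Lemma gvalE (G : set (X * X)) u k :
  (forall u k k', G (u, k) -> G (u, k') -> k = k') -> G (u, k) -> gval G u = k.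
Proof. by move=> h Guk; exact: h (gval_in Guk) Guk. Qed.

Lemma carrier_subspace : subspace H. Proof. by case: hA => -[]. Qed.

Lemma carrier0 : H 0. Proof. by case: carrier_subspace. Qed.

Lemma carrier_lin a u v : H u -> H v -> H (a *: u + v).
Proof. by case: carrier_subspace => _; apply. Qed.

Lemma gvalK u : H u -> K (u, gval K u).
Proof. by move=> /K_total[k Kuk]; exact: gval_in Kuk. Qed.

Lemma gvalK_lin a u v : H u -> H v -> gval K (a *: u + v) = a *: gval K u + gval K v.
Proof.
move=> Hu Hv; apply: gvalE => //; exact: SA_lin hK (gvalK Hu) (gvalK Hv).
Qed.

Lemma valK0 : gval K 0 = 0. Proof. apply: gvalE => //; exact: SA_0 hK. Qed.

Lemma gvalK_D u v : H u -> H v -> gval K (u + v) = gval K u + gval K v.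
Proof. by move=> Hu Hv; have := gvalK_lin 1 Hu Hv; rewrite !scale1r. Qed.

Lemma gvalK_Z a u : H u -> gval K (a *: u) = a *: gval K u.
Proof. by move=> Hu; have := gvalK_lin a Hu carrier0; rewrite valK0 !addr0. Qed.

Lemma gvalK_sym u v : H u -> H v -> ip (gval K u) v = ip u (gval K v).
Proof. by move=> Hu Hv; case: hK => _ _ s _; apply: s; exact: gvalK. Qed.

Lemma pencil_functional u w w' : T (u, w) -> T (u, w') -> w = w'.
Proof.
move=> [f Af Kf] [f' Af' Kf']; rewrite /= in Af Kf Af' Kf'.
by apply: (K_inj Kf); rewrite (A_fun Af Af').
Qed.

Lemma pencil_lin a u w v z : T (u, w) -> T (v, z) -> T (a *: u + v, a *: w + z).
Proof.
move=> [f Af Kf] [f' Af' Kf']; exists (a *: f + f') => /=.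
  exact: SA_lin hA Af Af'.
exact: SA_lin hK Kf Kf'.
Qed.

Lemma pencil0 : T (0, 0).
Proof. by exists 0; [exact: SA_0 hA|exact: SA_0 hK]. Qed.

Lemma pencilZ a u w : T (u, w) -> T (a *: u, a *: w).
Proof. by move=> h; have := pencil_lin a h pencil0; rewrite !addr0. Qed.

Lemma pencilD u w v z : T (u, w) -> T (v, z) -> T (u + v, w + z).
Proof. by move=> h1 h2; have := pencil_lin 1 h1 h2; rewrite !scale1r. Qed.

Lemma pencil_carrier u w : T (u, w) -> H u /\ H w.
Proof.
move=> [f Af Kf]; have [_ mA _ _] := hA; have [_ mK _ _] := hK.
by split; [exact: (mA _ _ Af).1|exact: (mK _ _ Kf).1].
Qed.

Lemma pencil_gval u w : T (u, w) -> gval A u = gval K w /\ A (u, gval A u).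
Proof.
move=> [f Af Kf]; rewrite /= in Af Kf; split; last exact: gval_in Af.
by rewrite (gvalE A_fun Af) (gvalE K_fun Kf).
Qed.

(** [u] is the end of a Jordan chain of length [n] for the eigenvalue [g]. *)
Fixpoint level g n u : Prop :=
  if n is m.+1 then exists w, level g m w /\ T (u, g *: u + w) else u = 0.

Definition root_space g : set X := [set u | exists n, level g n u].

Lemma gen_eigenspace_root_space g u : gen_eigenspace T g u -> root_space g u.
Proof.
move=> [n [f [f0 <- hf]]]; exists n.
elim: n hf => [|n IH] hf //=; exists (f n); split.
  by apply: IH => j jn; apply: hf; exact: ltnW.
exact: hf.
Qed.

Lemma level0 g n : level g n 0.
Proof.
elim: n => [|n IH] //=; exists 0; split => //; rewrite scaler0 addr0; exact: pencil0.
Qed.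

Lemma levelS g n u : level g n u -> level g n.+1 u.
Proof.
elim: n u => [|n IH] u; first by move=> ->; exact: level0.
by move=> [w [lw Tu]]; exists w; split => //; exact: IH.
Qed.

Lemma level_le g m n u : (m <= n)%N -> level g m u -> level g n u.
Proof.
move=> mn; rewrite -(subnK mn); elim: (n - m)%N => [|k IH] // h.
by rewrite addSn; apply: levelS; exact: IH.
Qed.

Lemma level_lin g n a u v : level g n u -> level g n v -> level g n (a *: u + v).
Proof.
elim: n u v => [|n IH] u v /=; first by move=> -> ->; rewrite scaler0 addr0.
move=> [w [lw Tu]] [z [lz Tv]]; exists (a *: w + z); split; first exact: IH.
have := pencil_lin a Tu Tv; congr (T (_, _)).
by rewrite !scalerDr !scalerA (mulrC g) addrACA.
Qed.

Lemma level_carrier g n u : level g n u -> H u.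
Proof.
case: n => [->|n [w [_ /pencil_carrier[]]]] //; exact: carrier0.
Qed.

Lemma root_space_subspace g : subspace (root_space g).
Proof.
split; first by exists 0%N.
move=> a u v [n lu] [m lv]; exists (maxn n m); apply: level_lin.
  by apply: level_le lu; exact: leq_maxl.
by apply: level_le lv; exact: leq_maxr.
Qed.

Lemma root_space_carrier g u : root_space g u -> H u.
Proof. by move=> [n]; exact: level_carrier. Qed.

Lemma root_space_pencil g u : root_space g u -> exists w, T (u, w).
Proof.
move=> [[->|n [w [_ Tu]]]]; first by exists 0; exact: pencil0.
by exists (g *: u + w).
Qed.

(** Induction on the total length of the chains: symmetry of [A] gives
    [(g - conj h) [u, v] = 0] once the terms with shorter chains vanish. *)
Lemma level_orthogonal g h n m u v : g != Num.conj h -> level g n u -> level h m v ->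
  ip (gval K u) v = 0.
Proof.
move=> gh; have gh' : g - Num.conj h != 0 by rewrite subr_eq0.
have [k] := ubnP (n + m); elim: k n m u v => // k IH [|n] [|m] u v kn.
- by move=> /= -> _; rewrite valK0 ip0l.
- by move=> /= -> _; rewrite valK0 ip0l.
- by move=> _ /= ->; rewrite ip0r.
move=> lu lv; have Hu := level_carrier lu; have Hv := level_carrier lv.
have [w [lw Tu]] := lu; have [z [lz Tv]] := lv.
have Hw := level_carrier lw; have Hz := level_carrier lz.
have e1 : ip (gval K w) v = 0.
  by apply: (IH n m.+1) => //; rewrite -ltnS -addSn.
have e2 : ip (gval K u) z = 0.
  by apply: (IH n.+1 m) => //; rewrite -ltnS -addnS.
have [_ _ sA _] := hA.
have [eAu Au] := pencil_gval Tu; have [eAv Av] := pencil_gval Tv.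
have := sA _ _ _ _ Au Av; rewrite eAu eAv.
rewrite !gvalK_D ?gvalK_Z //; try by apply: subZ => //; exact: carrier_subspace.
rewrite ipDl ipDr ipZl ipZr e1 -(gvalK_sym Hu Hz) e2 !addr0 -(gvalK_sym Hu Hv).
move/eqP; rewrite -subr_eq0 -mulrBl mulf_eq0 (negbTE gh') /=.
by move/eqP.
Qed.

Lemma root_orthogonal g h u v : g != Num.conj h -> root_space g u -> root_space h v ->
  ip (gval K u) v = 0 /\ ip (gval A u) v = 0.
Proof.
move=> gh [n lu] [m lv]; split; first exact: level_orthogonal gh lu lv.
case: n lu => [->|n [w [lw Tu]]].
  by rewrite (gvalE A_fun (SA_0 hA)) ip0l.
have lu : level g n.+1 u by exists w.
have [-> _] := pencil_gval Tu.
have Hu := level_carrier lu; have Hw := level_carrier lw.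
rewrite gvalK_D ?gvalK_Z //; last by apply: subZ => //; exact: carrier_subspace.
by rewrite ipDl ipZl (level_orthogonal gh lu lv) (level_orthogonal gh lw lv) mulr0 addr0.
Qed.

Lemma level_eigen_eq0 g h n u : g != h -> level h n u -> T (u, g *: u) -> u = 0.
Proof.
move=> gh; elim: n u => [|n IH] u //= [w [lw Tu]] Tg.
have e := pencil_functional Tg Tu.
have ew : w = (g - h) *: u by rewrite scalerBl e addrAC subrr add0r.
have w0 : w = 0.
  apply: IH => //; rewrite ew scalerA mulrC -scalerA; exact: pencilZ.
move/eqP: ew; rewrite w0 eq_sym scaler_eq0 subr_eq0 (negbTE gh) /=.
by move/eqP.
Qed.

(** Apply [T - g] to a vanishing sum: the chain of the component for [g] gets
    shorter, and [T - g] is injective on the other root spaces. *)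
Lemma root_independent (l : seq R[i]) (U : R[i] -> X) : uniq l ->
  (forall g, g \in l -> root_space g (U g)) -> \sum_(g <- l) U g = 0 ->
  forall g, g \in l -> U g = 0.
Proof.
elim: l U => [|g l IH] U //= /andP[gl ul] hU.
rewrite big_cons => sU.
(* [x] is the component for [g], with a chain of length [n] *)
suff key n : forall x (Y : R[i] -> X), level g n x ->
    (forall h, h \in l -> root_space h (Y h)) ->
    x + \sum_(h <- l) Y h = 0 -> x = 0 /\ forall h, h \in l -> Y h = 0.
  have [n ln] := hU g (mem_head _ _).
  have [|h1 h2] := key n (U g) U ln _ sU.
    by move=> h hl; apply: hU; rewrite inE hl orbT.
  by move=> h; rewrite inE => /orP[/eqP->|/h2].
elim: n => [|n IHn] x Y lx hY sY.
  move: lx => /= x0; split => //; rewrite x0 add0r in sY; exact: IH hY sY.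
have [y [ly Tx]] := lx.
have hT h : h \in l -> exists z, root_space h z /\ T (Y h, h *: Y h + z).
  move=> /hY[[->|m [z [lz Tz]]]].
    exists 0; split; first by exists 0%N.
    by rewrite scaler0 addr0; exact: pencil0.
  by exists z; split => //; exists m.
have [Z hZ] : exists Z : R[i] -> X, forall h, h \in l ->
    root_space h (Z h) /\ T (Y h, h *: Y h + Z h).
  exists (fun h => xget 0 [set z | root_space h z /\ T (Y h, h *: Y h + z)]).
  by move=> h /hT ex; have := xgetPex 0 ex.
pose D h := (h - g) *: Y h + Z h.
have TD h : h \in l -> T (Y h, g *: Y h + D h).
  by move=> /hZ[_]; rewrite /D scalerBl (addrA (g *: _)) (addrC (g *: _)) subrK.
have sD : y + \sum_(h <- l) D h = 0.
  have T1 : T (\sum_(h <- l) Y h, \sum_(h <- l) (g *: Y h + D h)).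
    rewrite big_seq [X in T (_, X)]big_seq.
    elim/big_ind2 : _ => [|u1 w1 u2 w2 t1 t2|h /TD //]; first exact: pencil0.
    exact: pencilD.
  have := pencilD Tx T1; rewrite sY => /pencil_functional/(_ pencil0).
  by rewrite big_split /= addrACA -scaler_sumr -scalerDr sY scaler0 add0r.
have [|y0 D0] := IHn y D ly _ sD.
  move=> h hl; have sr := root_space_subspace h.
  by apply: (subD sr); [apply: (subZ _ sr); exact: hY|exact: (hZ _ hl).1].
have Y0 h : h \in l -> Y h = 0.
  move=> hl; have [m lm] := hY _ hl; apply: (level_eigen_eq0 (g := g) _ lm).
    by apply: contraNneq gl => ->.
  by have := TD _ hl; rewrite D0 // addr0.
split => //; move: sY; rewrite big_seq big1 ?addr0 //.
Qed.

(** * The nilpotent part on a root space and its polynomials *)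

(** [T - g] on the root space of [g], where it is locally nilpotent. *)
Definition nilpart g u : X := gval T u - g *: u.

Lemma nilpartE g u w : T (u, g *: u + w) -> nilpart g u = w.
Proof. by move=> Tu; rewrite /nilpart (gvalE pencil_functional Tu) addrAC subrr add0r. Qed.

Lemma nilpart_level g n u : level g n.+1 u -> level g n (nilpart g u).
Proof. by move=> [w [lw Tu]]; rewrite (nilpartE Tu). Qed.

Lemma nilpart_pencil g u : root_space g u -> T (u, g *: u + nilpart g u).
Proof.
move=> /root_space_pencil[w Tu].
by rewrite /nilpart (gvalE pencil_functional Tu) addrC subrK.
Qed.

Lemma nilpart_root g u : root_space g u -> root_space g (nilpart g u).
Proof. by move=> [n lu]; exists n; apply: nilpart_level; exact: levelS. Qed.

Lemma nilpart_lin g a u v : root_space g u -> root_space g v ->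
  nilpart g (a *: u + v) = a *: nilpart g u + nilpart g v.
Proof.
move=> ru rv; apply: nilpartE; have := pencil_lin a (nilpart_pencil ru) (nilpart_pencil rv).
by congr (T (_, _)); rewrite !scalerDr !scalerA (mulrC a) addrACA.
Qed.

Lemma nilpart0 g : nilpart g 0 = 0.
Proof. by apply: nilpartE; rewrite scaler0 addr0; exact: pencil0. Qed.

Lemma iter_nilpart_root g i u : root_space g u -> root_space g (iter i (nilpart g) u).
Proof. by move=> ru; elim: i => //= i; exact: nilpart_root. Qed.

Lemma iter_nilpart_lin g a i u v : root_space g u -> root_space g v ->
  iter i (nilpart g) (a *: u + v) = a *: iter i (nilpart g) u + iter i (nilpart g) v.
Proof.
move=> ru rv; elim: i => //= i ->; apply: nilpart_lin; exact: iter_nilpart_root.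
Qed.

Lemma iter_nilpart0 g i : iter i (nilpart g) 0 = 0.
Proof. by elim: i => //= i ->; exact: nilpart0. Qed.

Lemma iter_nilpart_level g n u : level g n u -> iter n (nilpart g) u = 0.
Proof. by elim: n u => //= n IH u /nilpart_level/IH; rewrite -iterS iterSr. Qed.

Lemma gvalA g u : root_space g u -> gval A u = g *: gval K u + gval K (nilpart g u).
Proof.
move=> ru; have [-> _] := pencil_gval (nilpart_pencil ru).
have Hu := root_space_carrier ru; have Hn := root_space_carrier (nilpart_root ru).
by rewrite gvalK_D ?gvalK_Z //; apply: subZ => //; exact: carrier_subspace.
Qed.

(** Symmetry of [A] and of [K], as [A = K (g + N)] with [g] real. *)
Lemma nilpart_sym g u v : Num.conj g = g -> root_space g u -> root_space g v ->
  ip (gval K (nilpart g u)) v = ip (gval K u) (nilpart g v).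
Proof.
move=> gr ru rv; have [_ _ sA _] := hA.
have [_ Au] := pencil_gval (nilpart_pencil ru); have [_ Av] := pencil_gval (nilpart_pencil rv).
have := sA _ _ _ _ Au Av; rewrite (gvalA ru) (gvalA rv).
have Hu := root_space_carrier ru; have Hv := root_space_carrier rv.
have Hnv := root_space_carrier (nilpart_root rv).
rewrite ipDl ipDr ipZl ipZr gr -(gvalK_sym Hu Hv) -(gvalK_sym Hu Hnv).
exact: addrI.
Qed.

Lemma iter_nilpart_sym g i u v : Num.conj g = g -> root_space g u -> root_space g v ->
  ip (gval K (iter i (nilpart g) u)) v = ip (gval K u) (iter i (nilpart g) v).
Proof.
move=> gr ru; elim: i v => //= i IH v rv.
rewrite nilpart_sym //; last exact: iter_nilpart_root.
rewrite IH; last exact: nilpart_root.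
by rewrite -[iter i _ (nilpart g v)]iterSr.
Qed.

Implicit Types p q : {poly R}.

Definition nilpoly g (p : {poly R}) u : X :=
  \sum_(i < size p) (p`_i)%:C *: iter i (nilpart g) u.

Lemma nilpoly_widen g p u m : (size p <= m)%N ->
  nilpoly g p u = \sum_(i < m) (p`_i)%:C *: iter i (nilpart g) u.
Proof.
move=> pm; rewrite /nilpoly -!(big_mkord xpredT (fun i => (p`_i)%:C *: iter i (nilpart g) u)).
rewrite [RHS](big_cat_nat (n := size p)) //= [X in _ + X]big_nat_cond.
rewrite [X in _ + X]big1 ?addr0 // => i /andP[/andP[ip' _] _].
by rewrite nth_default // scale0r.
Qed.

Lemma nilpolyD g p q u : nilpoly g (p + q) u = nilpoly g p u + nilpoly g q u.
Proof.
pose m := maxn (size p) (size q).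
rewrite (@nilpoly_widen g (p + q) u m) ?size_polyD //.
rewrite (@nilpoly_widen g p u m) ?leq_maxl // (@nilpoly_widen g q u m) ?leq_maxr //.
by rewrite -big_split; apply: eq_bigr => i _ /=; rewrite coefD rmorphD scalerDl.
Qed.

Lemma nilpolyC g c u : nilpoly g c%:P u = c%:C *: u.
Proof.
rewrite (@nilpoly_widen g _ u 1) ?size_polyC_leq1 //.
by rewrite big_ord_recl big_ord0 addr0 /= coefC.
Qed.

Lemma nilpolyMX g p u : nilpoly g (p * 'X) u = nilpoly g p (nilpart g u).
Proof.
rewrite (@nilpoly_widen g (p * 'X) u (size p).+1); last first.
  by apply: leq_trans (size_polyMleq _ _) _; rewrite size_polyX addn2.
rewrite big_ord_recl coefMX eqxx /= scale0r add0r; apply: eq_bigr => i _.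
by rewrite coefMX /= -iterSr.
Qed.

Lemma root_sum g I (r : seq I) (F : I -> X) (c : I -> R[i]) :
  (forall i, root_space g (F i)) -> root_space g (\sum_(i <- r) c i *: F i).
Proof.
move=> hF; have sr := root_space_subspace g; apply: big_ind; first by case: sr.
  by move=> x y; exact: subD.
by move=> i _; exact: subZ.
Qed.

Lemma nilpoly_root g p u : root_space g u -> root_space g (nilpoly g p u).
Proof.
move=> ru; apply: (root_sum _ (F := fun i : 'I_(size p) => iter i (nilpart g) u)).
by move=> i; exact: iter_nilpart_root.
Qed.

Lemma nilpoly_lin g p a u v : root_space g u -> root_space g v ->
  nilpoly g p (a *: u + v) = a *: nilpoly g p u + nilpoly g p v.
Proof.
move=> ru rv; rewrite /nilpoly scaler_sumr -big_split; apply: eq_bigr => i _ /=.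
by rewrite iter_nilpart_lin // scalerDr !scalerA (mulrC a).
Qed.

Lemma nilpoly0 g p : nilpoly g p 0 = 0.
Proof. by rewrite /nilpoly big1 // => i _; rewrite iter_nilpart0 scaler0. Qed.

Lemma nilpolyM g p q u : root_space g u ->
  nilpoly g (p * q) u = nilpoly g p (nilpoly g q u).
Proof.
elim/poly_ind: q u => [|q c IH] u ru.
  have z w : nilpoly g 0 w = 0 by rewrite -polyC0 nilpolyC scale0r.
  by rewrite mulr0 !z nilpoly0.
rewrite mulrDr mulrA !nilpolyD !nilpolyMX IH; last exact: nilpart_root.
rewrite nilpolyC (addrC _ (c%:C *: u)) nilpoly_lin //; last first.
  by apply: nilpoly_root; exact: nilpart_root.
rewrite addrC; congr (_ + _); rewrite mulrC mul_polyC /nilpoly.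
rewrite -/(nilpoly g p u) -/(nilpoly g (c *: p) u).
rewrite (@nilpoly_widen g (c *: p) u (size p)) ?size_scale_leq // /nilpoly scaler_sumr.
by apply: eq_bigr => i _; rewrite coefZ rmorphM scalerA.
Qed.

Lemma gvalK_sum I (r : seq I) (c : I -> R[i]) (F : I -> X) v :
  (forall i, H (F i)) ->
  ip (gval K (\sum_(i <- r) c i *: F i)) v = \sum_(i <- r) c i * ip (gval K (F i)) v.
Proof.
move=> hF; elim: r => [|i r IH]; first by rewrite !big_nil valK0 ip0l.
rewrite !big_cons gvalK_lin ?ipDl ?ipZl ?IH //.
elim: (r) => [|j r' hr']; first by rewrite big_nil; exact: carrier0.
by rewrite big_cons; exact: carrier_lin.
Qed.

Lemma nilpoly_sym g p u v : Num.conj g = g -> root_space g u -> root_space g v ->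
  ip (gval K (nilpoly g p u)) v = ip (gval K u) (nilpoly g p v).
Proof.
move=> gr ru rv; rewrite /nilpoly gvalK_sum; last first.
  by move=> i; exact: root_space_carrier (iter_nilpart_root _ ru).
rewrite ip_sum_r; apply: eq_bigr => i _.
by rewrite ipZr iter_nilpart_sym //; congr (_ * _); exact/esym/conjc_real.
Qed.

Lemma nilpolyMXn g p n u : nilpoly g (p * 'X ^+ n) u = nilpoly g p (iter n (nilpart g) u).
Proof.
elim: n u => [|n IH] u; first by rewrite expr0 mulr1.
by rewrite exprSr mulrA nilpolyMX IH -iterSr.
Qed.

(** * The form s [u, u] - (A u, u) *)

Definition shifted_form (s : R) u : R := s * re (gval K u) u - re (gval A u) u.

(** With [p * p * (s - g - 'X) = 1] modulo ['X^n] and [x = p(N) u],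
    s [x, x] - (A x, x) = [(s - g - N) x, x] = [p(N)^2 (s - g - N) u, u], which
    equals [u, u] on chains of length [n]. The polynomial [p'] inverts [p] there. *)
Lemma shifted_form_sqrt g (s : R) n : complex.Im g = 0 -> complex.Re g < s ->
  exists p p' : {poly R}, forall u, level g n u ->
    nilpoly g p' (nilpoly g p u) = u /\
    shifted_form s (nilpoly g p u) = re (gval K u) u.
Proof.
move=> g0 gs; have t0 : 0 < s - complex.Re g by rewrite subr_gt0.
have [p [q hpq]] := poly_inv_sqrt n t0.
have gr : g = (complex.Re g)%:C by rewrite [LHS]complexE g0 mulr0 addr0.
have gc : Num.conj g = g by rewrite gr; exact: conjc_real.
exists p, (p * ((s - complex.Re g)%:P - 'X)) => u lu.
have ru : root_space g u by exists n.
have key : nilpoly g (p * ((s - complex.Re g)%:P - 'X) * p) u = u.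
  rewrite mulrAC hpq nilpolyD mulrC nilpolyMXn iter_nilpart_level // nilpoly0 addr0.
  by rewrite -polyC1 nilpolyC scale1r.
split; first by rewrite -nilpolyM.
set x := nilpoly g p u; have rx : root_space g x by exact: nilpoly_root.
have ex : nilpoly g ((s - complex.Re g)%:P - 'X) x =
    s%:C *: x - (g *: x + nilpart g x).
  rewrite -(mulN1r 'X) -polyC1 -polyCN nilpolyD nilpolyMX !nilpolyC.
  rewrite (_ : (- 1)%:C = -1) ?scaleN1r; last exact: rmorphN1.
  have esg : (s - complex.Re g)%:C = s%:C - g by rewrite [X in _ = _ - X]gr -rmorphB.
  by rewrite esg scalerBl (opprD (g *: x)) addrA.
have rg : root_space g (g *: x + nilpart g x).
  have sr := root_space_subspace g.
  by apply: (subD sr); [exact: subZ sr rx|exact: nilpart_root].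
have eB : ip (gval K (nilpoly g ((s - complex.Re g)%:P - 'X) x)) x =
    s%:C * ip (gval K x) x - ip (gval A x) x.
  have [-> _] := pencil_gval (nilpart_pencil rx).
  have Hx := root_space_carrier rx; have Hg := root_space_carrier rg.
  have -> : nilpoly g ((s - complex.Re g)%:P - 'X) x =
      (- 1) *: (g *: x + nilpart g x) + s%:C *: x by rewrite ex scaleN1r addrC.
  rewrite (gvalK_lin _ Hg); last exact: (subZ _ carrier_subspace Hx).
  by rewrite (gvalK_Z _ Hx) ipDl !ipZl mulN1r addrC.
have -> : shifted_form s x = complex.Re (s%:C * ip (gval K x) x - ip (gval A x) x).
  by rewrite cReD cReN cReM /= mul0r subr0.
have rtx : root_space g (nilpoly g ((s - complex.Re g)%:P - 'X) x) by exact: nilpoly_root.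
rewrite -eB {2}/x -(nilpoly_sym _ gc rtx ru) -(nilpolyM _ _ rx) /x -(nilpolyM _ _ ru).
by rewrite key.
Qed.

(** All members of the family lie at one common level, so a single polynomial
    serves for the whole span. *)
Lemma shifted_form_family g (s : R) n (v : 'I_n -> X) : complex.Im g = 0 ->
  complex.Re g < s -> (forall i, root_space g (v i)) -> lin_indep v ->
  (forall c : 'I_n -> R[i], 0 <= re (gval K (\sum_i c i *: v i)) (\sum_i c i *: v i)) ->
  exists v' : 'I_n -> X, [/\ forall i, root_space g (v' i), lin_indep v' &
    forall c : 'I_n -> R[i], 0 <= shifted_form s (\sum_i c i *: v' i)].
Proof.
move=> g0 gs rv lv pv.
have [m hm] : exists m, forall i, level g m (v i).
  have [f hf] := choice rv; exists (\max_i f i) => i.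
  by apply: level_le (hf i); exact: leq_bigmax.
have [p [p' hp]] := shifted_form_sqrt m g0 gs.
have lin c : level g m (\sum_i c i *: v i).
  apply: big_ind => [|x y hx hy|i _]; first exact: level0.
    by have := level_lin 1 hx hy; rewrite scale1r.
  by have := level_lin (c i) (hm i) (level0 g m); rewrite addr0.
have epact c : \sum_i c i *: nilpoly g p (v i) = nilpoly g p (\sum_i c i *: v i).
  suff h (l : seq 'I_n) : root_space g (\sum_(i <- l) c i *: v i) /\
     \sum_(i <- l) c i *: nilpoly g p (v i) = nilpoly g p (\sum_(i <- l) c i *: v i).
    exact: (h _).2.
  elim: l => [|i l [rl IHl]].
    by rewrite !big_nil nilpoly0; split => //; case: (root_space_subspace g).
  rewrite !big_cons IHl nilpoly_lin //; split => //.
  by have [_ sr] := root_space_subspace g; exact: sr.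
exists (fun i => nilpoly g p (v i)); split.
- by move=> i; exact: nilpoly_root.
- move=> c; rewrite epact => e; apply: lv.
  by have [<- _] := hp _ (lin c); rewrite e nilpoly0.
- by move=> c; rewrite epact (hp _ (lin c)).2.
Qed.

(** A nonreal [g] differs from its conjugate, so its root space is orthogonal to
    itself for both forms. *)
Lemma shifted_form_nonreal g s u : complex.Im g != 0 -> root_space g u -> shifted_form s u = 0.
Proof.
move=> g0 ru; have gg : g != Num.conj g.
  apply: contraNneq g0 => /(congr1 (@complex.Im R)); rewrite cImJ => e.
  by apply/eqP; lra.
have [h1 h2] := root_orthogonal gg ru ru.
by rewrite /shifted_form /re h1 h2 /= mulr0 subrr.
Qed.

Lemma root_dom g u : root_space g u -> A (u, gval A u).
Proof. by move=> /root_space_pencil[w /pencil_gval[]]. Qed.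

Lemma gvalA_D u v : A (u, gval A u) -> A (v, gval A v) ->
  A (u + v, gval A u + gval A v) /\ gval A (u + v) = gval A u + gval A v.
Proof.
move=> Au Av; have h := SA_D hA Au Av; split => //; exact: gvalE.
Qed.

(** Distinct [g] and [h] in the closed upper half-plane satisfy [g <> conj h],
    so all cross terms vanish. *)
Lemma shifted_form_sum (s : R) (l : seq R[i]) (U : R[i] -> X) : uniq l ->
  (forall g, g \in l -> 0 <= complex.Im g) ->
  (forall g, g \in l -> root_space g (U g)) ->
  (forall g, g \in l -> 0 <= shifted_form s (U g)) ->
  let u := \sum_(g <- l) U g in A (u, gval A u) /\ 0 <= shifted_form s u.
Proof.
elim: l => [|g l IH] /= ul il rl el.
  rewrite big_nil /shifted_form !re0r mulr0 subrr; split => //.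
  by apply: gval_in; exact: SA_0 hA.
have {ul} /andP[gl ul] := ul.
have sub h : h \in l -> h \in g :: l by rewrite inE orbC => ->.
have [||||Ay ey] := IH.
- exact: ul.
- by move=> h /sub; exact: il.
- by move=> h /sub; exact: rl.
- by move=> h /sub; exact: el.
rewrite big_cons; set y := \sum_(h <- l) _ in Ay ey *.
have gin : g \in g :: l by rewrite inE eqxx.
set x := U g; have rx : root_space g x by exact: rl.
have [Axy exy] := gvalA_D (root_dom rx) Ay.
split; first by rewrite exy.
have [_ mA sA _] := hA.
have Hx := root_space_carrier rx; have [Hy _] := mA _ _ Ay.
have gh h : h \in l -> g != Num.conj h.
  move=> hl; apply: contraNneq gl => gh.
  have i1 := il _ gin; have i2 := il _ (sub _ hl).
  have e1 := congr1 (@complex.Im R) gh; rewrite cImJ in e1.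
  have e2 := congr1 (@complex.Re R) gh; rewrite cReJ in e2.
  suff -> : g = h by [].
  by apply/eqP; rewrite eq_complex e2 eqxx /=; apply/eqP; lra.
have orth h : h \in l -> ip (gval K x) (U h) = 0 /\ ip (gval A x) (U h) = 0.
  by move=> hl; exact: root_orthogonal (gh _ hl) rx (rl _ (sub _ hl)).
have K0 : ip (gval K x) y = 0 /\ ip (gval A x) y = 0.
  by rewrite /y !ip_sum_r !big_seq; split; apply: big1 => h /orth[].
have K1 : ip (gval K y) x = 0 by rewrite (gvalK_sym Hy Hx) ipC K0.1 rmorph0.
have A1 : ip (gval A y) x = 0.
  by rewrite (sA _ _ _ _ Ay (root_dom rx)) ipC K0.2 rmorph0.
have -> : shifted_form s (x + y) = shifted_form s x + shifted_form s y.
  rewrite /shifted_form exy (gvalK_D Hx Hy) !reDl !reDr /re K0.1 K0.2 K1 A1 /=; ring.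
by rewrite addr_ge0 // el.
Qed.

Variables (omp omm : R).
Hypothesis A_bound : forall u a, A (u, a) ->
  ortho (discrete_eigenvectors H A) u -> omp * sq u <= re a u.
Hypothesis K_bound : forall u k, K (u, k) ->
  ortho (discrete_eigenvectors H K) u -> re k u <= omm^-1 * sq u.
Hypotheses (omp0 : 0 < omp) (omm0 : 0 < omm).

(** * Counting root vectors *)

Lemma shifted_form_orth0 (s : R) u : 0 <= s -> s < omp * omm ->
  A (u, gval A u) -> 0 <= shifted_form s u ->
  ortho (discrete_eigenvectors H A) u -> ortho (discrete_eigenvectors H K) u ->
  u = 0.
Proof.
move=> s0 sw Au eu oA oK; have [_ mA _ _] := hA.
have h1 := A_bound Au oA.
have h2 := K_bound (gvalK (mA _ _ Au).1) oK.
apply: (@sq_eq0 _ _ ip); apply/eqP; rewrite eq_le sq_ge0 andbT.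
have h3 : s * re (gval K u) u <= s * (omm^-1 * sq u) by rewrite ler_wpM2l.
have h4 : s * omm^-1 < omp by rewrite ltr_pdivrMr.
rewrite /shifted_form in eu; have := sq_ge0 ip u; nra.
Qed.

Definition nonneg_family (s : R) g n (v : nat -> X) : Prop :=
  [/\ forall i : 'I_n, root_space g (v i), lin_indep (fun i : 'I_n => v i) &
    forall c : 'I_n -> R[i], 0 <= shifted_form s (\sum_(i < n) c i *: v i)].

(** If the families had more than [size sA + size sK] members, some nontrivial
    combination of them would be orthogonal to [sA] and [sK], hence 0 by
    [shifted_form_orth0]; root spaces and families are independent. *)
Lemma nonneg_family_count (s : R) (l : seq R[i]) (n : R[i] -> nat) (v : R[i] -> nat -> X)
    (sA sK : seq X) :
  0 <= s -> s < omp * omm -> uniq l ->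
  (forall g, g \in l -> 0 <= complex.Im g) ->
  (forall g, g \in l -> nonneg_family s g (n g) (v g)) ->
  (forall u, orth_list u sA -> ortho (discrete_eigenvectors H A) u) ->
  (forall u, orth_list u sK -> ortho (discrete_eigenvectors H K) u) ->
  (\sum_(g <- l) n g <= size sA + size sK)%N.
Proof.
move=> s0 sw ul il hv hsA hsK; rewrite leqNgt; apply/negP => lt.
pose L := [seq (g, k) | g <- l, k <- iota 0 (n g)].
have uL : uniq L.
  apply: allpairs_uniq_dep => //; first by move=> g _; exact: iota_uniq.
  by move=> [g k] [g' k'] _ _ /= [-> ->].
have sL : size L = \sum_(g <- l) n g.
  rewrite /L size_allpairs_dep sumnE big_map; apply: eq_bigr => g _.
  exact: size_iota.
have [|c [[[g k] gkL cgk] hc]] :=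
    lin_system_seq (fun x : R[i] * nat => v x.1 x.2) (s := sA ++ sK) uL.
  by rewrite size_cat sL.
pose U h := \sum_(i < n h) c (h, val i) *: v h i.
have eU : \sum_(x <- L) c x *: v x.1 x.2 = \sum_(h <- l) U h.
  rewrite /L big_allpairs_dep; apply: eq_bigr => h _.
  by rewrite /U -(big_mkord xpredT (fun i => c (h, i) *: v h i)) /index_iota subn0.
rewrite eU in hc.
have rU h : h \in l -> root_space h (U h).
  by move=> /hv[rv _ _]; exact: root_sum.
have [||Au eu] := @shifted_form_sum s l U ul il.
- exact: rU.
- by move=> h /hv[_ _ ev]; exact: ev.
have u0 : \sum_(h <- l) U h = 0.
  apply: (shifted_form_orth0 s0 sw Au eu).
    by apply: hsA => e es; apply: hc; rewrite mem_cat es.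
  by apply: hsK => e es; apply: hc; rewrite mem_cat es orbT.
have gl : g \in l by have /allpairsPdep[g' [k' [gl _ [-> _]]]] := gkL.
have kn : (k < n g)%N.
  have /allpairsPdep[g' [k' [_ + [-> ->]]]] := gkL.
  by rewrite mem_iota.
have Ug := root_independent ul rU u0 gl.
have [_ lv _] := hv _ gl.
by have := lv _ Ug (Ordinal kn) => /= c0; rewrite c0 eqxx in cgk.
Qed.

(** An independent family of [n] root vectors for [g] that is counted on the
    left-hand side: nonnegative for [ , ] if [g] is real, arbitrary otherwise. *)
Definition admissible g n : Prop := exists v : 'I_n -> X,
  [/\ forall i, gen_eigenspace T g (v i), lin_indep v &
    complex.Im g = 0 -> forall c : 'I_n -> R[i],
      0 <= re (gval K (\sum_i c i *: v i)) (\sum_i c i *: v i)].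

Lemma admissible_nonneg_family (s : R) g n : (complex.Im g = 0 -> complex.Re g < s) ->
  admissible g n -> exists v, nonneg_family s g n v.
Proof.
move=> gs [v [gv lv pv]].
have rv i : root_space g (v i) by exact: (gen_eigenspace_root_space (gv i)).
have [g0|g0] := eqVneq (complex.Im g) 0.
  have [v' [rv' lv' ev']] :=
    shifted_form_family g0 (gs g0) rv lv (pv g0).
  have [v'' ev''] := nat_family v'; exists v''.
  by rewrite -ev'' in rv' lv' ev'.
have [v'' ev''] := nat_family v; exists v''; rewrite -ev'' in rv lv.
split => // c; rewrite (shifted_form_nonreal _ g0) //.
exact: root_sum.
Qed.

Lemma exists_shift (l : seq R[i]) :
  (forall g, g \in l -> complex.Im g = 0 -> complex.Re g < omp * omm) ->
  exists s : R, [/\ 0 <= s, s < omp * omm &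
    forall g, g \in l -> complex.Im g = 0 -> complex.Re g < s].
Proof.
have o0 : 0 < omp * omm by exact: mulr_gt0.
elim: l => [|g l IH] hl; first by exists 0; split.
have [|s [s0 sw hs]] := IH.
  by move=> h hh; apply: hl; rewrite inE hh orbT.
have [gi|gi] := eqVneq (complex.Im g) 0; last first.
  exists s; split => // h; rewrite inE => /orP[/eqP->|]; last exact: hs.
  by move=> gi'; rewrite gi' eqxx in gi.
have gw := hl g (mem_head _ _) gi.
exists (Num.max s ((complex.Re g + omp * omm) / 2)); split.
- by rewrite le_max s0.
- by rewrite gt_max sw /=; lra.
move=> h; rewrite inE => /orP[/eqP->|hh] hi; rewrite lt_max.
  by apply/orP; right; lra.
by rewrite (hs h hh hi).
Qed.

(** A common upper bound for [Np g] and for the dimension of the root space of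
    a nonreal [g]. *)
Definition root_count g : \bar R := ereal_sup [set ((n%:R : R)%:E) | n in admissible g].

Lemma admissible0 g : admissible g 0.
Proof.
have f0 : 'I_0 -> X by case.
exists f0; split => [[]|c _ []|_ c] //.
by rewrite big_ord0 re0r.
Qed.

Lemma root_count_ge0 g : (0 <= root_count g)%E.
Proof. by apply: ereal_sup_ubound; exists 0%N => //; exact: admissible0. Qed.

Lemma root_count_Np g : (Np ip A K g <= root_count g)%E.
Proof.
apply: ge_ereal_sup => _ [W [sW Wg Wp] <-].
apply: ge_ereal_sup => _ [n [v [Wv lv]] <-].
apply: ereal_sup_ubound; exists n => //; exists v; split => //.
  by move=> i; exact: Wg.
move=> _ c; have Wc : W (\sum_i c i *: v i).
  apply: big_ind; first by case: sW.
    by move=> x y; exact: subD.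
  by move=> i _; exact: subZ.
by have := Wp _ Wc; rewrite lecE => /andP[].
Qed.

Lemma root_count_dim g : complex.Im g != 0 ->
  (dim (gen_eigenspace T g) <= root_count g)%E.
Proof.
move=> g0; apply: ge_ereal_sup => _ [n [v [Wv lv]] <-].
apply: ereal_sup_ubound; exists n => //; exists v; split => // g0'.
by rewrite g0' eqxx in g0.
Qed.

Lemma root_count_sum (l : seq R[i]) (sA sK : seq X) : uniq l ->
  (forall g, g \in l -> 0 <= complex.Im g) ->
  (forall g, g \in l -> complex.Im g = 0 -> complex.Re g < omp * omm) ->
  (forall u, orth_list u sA -> ortho (discrete_eigenvectors H A) u) ->
  (forall u, orth_list u sK -> ortho (discrete_eigenvectors H K) u) ->
  (\sum_(g <- l) root_count g <= ((size sA + size sK)%:R : R)%:E)%E.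
Proof.
move=> ul il wl hsA hsK; apply: sum_sup_le_nat => //; first exact: admissible0.
move=> n hn; have [s [s0 sw hs]] := exists_shift wl.
have [v hv] : exists v : R[i] -> nat -> X,
    forall g, g \in l -> nonneg_family s g (n g) (v g).
  exists (fun g => xget (fun=> 0) [set w | nonneg_family s g (n g) w]) => g gl.
  have ex := admissible_nonneg_family (hs g gl) (hn g gl).
  exact: (xgetPex (fun=> 0) ex).
exact: nonneg_family_count s0 sw ul il hv hsA hsK.
Qed.

End Pencil.

(** * The isolated subspaces and the theorem *)

Section Dimensions.
Variables (R : realType) (X : completeNormedModType R[i]).
Variable ip : {dot X for Num.conj}.
Local Notation ortho := (Defs.ortho ip).
Local Notation dim := Defs.dim.
Local Notation eigenspace := Defs.eigenspace.
Local Notation SA := (self_adjoint_in ip).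
Implicit Types (T : set (X * X)) (M : set X).

Hypothesis ipn : inner_product_compatible ip.

Local Notation orth_list := (orth_list ip).

Lemma isolated_subspace_eigen M T (J : set R[i]) g e :
  discrete_spectrum M T g -> J g -> eigenspace T g e -> isolated_subspace M T J e.
Proof.
move=> dg Jg Te; exists 1%N, (fun=> 1), (fun=> e); split.
  by move=> _; exists g.
by rewrite big_ord_recl big_ord0 addr0 scale1r.
Qed.

Lemma isolated_subspace0 M T (J : set R[i]) : isolated_subspace M T J 0.
Proof.
exists 0%N, (fun=> 0), (fun=> 0); split => [[]|] //.
by rewrite big_ord0.
Qed.

Lemma real_sign_cases (g : R[i]) : complex.Im g = 0 -> [\/ g < 0, g = 0 | 0 < g].
Proof.
move=> g0; have -> : g = (complex.Re g)%:C by rewrite [LHS]complexE g0 mulr0 addr0.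
rewrite !ltcR; case: (ltgtP (complex.Re g) 0) => h.
- exact: Or31.
- exact: Or33.
- by apply: Or32; rewrite h.
Qed.

(** A discrete eigenvalue is real, so its eigenvectors lie in one of the three
    summands. *)
Lemma N_A_list M T : SA M T -> (N_A M T < +oo)%E -> exists s : seq X,
  N_A M T = ((size s)%:R : R)%:E /\
  forall u, orth_list u s -> ortho (discrete_eigenvectors M T) u.
Proof.
move=> h /(dim_list ip)[s [_ es hs]]; exists s; split => // u /hs Ou e [g dg Te].
have [->|e0] := eqVneq e 0; first exact: ip0r.
apply: Ou; have i0 := isolated_subspace0 M T.
have [gn|gz|gp] := real_sign_cases (SA_eig_real h Te e0).
- exists e; last by exists 0 => //; rewrite addr0.
  exists e; last by exists 0 => //; rewrite addr0.
  exact: isolated_subspace_eigen dg gn Te.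
- exists e; last by exists 0 => //; rewrite addr0.
  exists 0 => //; exists e; last by rewrite add0r.
  exact: isolated_subspace_eigen dg gz Te.
- exists 0; first by exists 0 => //; exists 0 => //; rewrite addr0.
  exists e; last by rewrite add0r.
  exact: isolated_subspace_eigen dg gp Te.
Qed.

(** As 0 is not an eigenvalue, the two signs cover the discrete spectrum. *)
Lemma N_K_list M T : SA M T -> (forall e, T (e, 0) -> e = 0) ->
  (N_K M T < +oo)%E -> exists s : seq X,
  N_K M T = ((size s)%:R : R)%:E /\
  forall u, orth_list u s -> ortho (discrete_eigenvectors M T) u.
Proof.
move=> h inj /(dim_list ip)[s [_ es hs]]; exists s; split => // u /hs Ou e [g dg Te].
have [->|e0] := eqVneq e 0; first exact: ip0r.
apply: Ou; have i0 := isolated_subspace0 M T.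
have [gn|gz|gp] := real_sign_cases (SA_eig_real h Te e0).
- exists e; last by exists 0 => //; rewrite addr0.
  exact: isolated_subspace_eigen dg gn Te.
- by move: Te e0; rewrite gz /Defs.eigenspace /= scale0r => /inj ->; rewrite eqxx.
- exists 0 => //; exists e; last by rewrite add0r.
  exact: isolated_subspace_eigen dg gp Te.
Qed.

Lemma dim_ge0 (S : set X) : (0 <= dim S)%E.
Proof.
apply: ereal_sup_ubound; exists 0%N => //.
have f0 : 'I_0 -> X by case.
by exists f0; split=> [[]|c _ []].
Qed.

End Dimensions.

Theorem theorem4 (R : realType) (X : completeNormedModType R[i])
    (ip : {dot X for Num.conj}) (Lp Lm : set (X * X)) (omp omm : R) :
  inner_product_compatible ip ->
  self_adjoint ip Lp -> self_adjoint ip Lm ->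
  essential_spectrum_assumption ip Lp omp ->
  essential_spectrum_assumption ip Lm omm ->
  discrete_spectrum_assumption Lp -> discrete_spectrum_assumption Lm ->
  0 < omp -> 0 < omm ->
  let H := spaceH ip Lm in
  let A := opA ip Lp Lm in
  let K := opK ip Lm in
  (forall g, ~ embedded_pencil_eigenvalue A K omp omm g) ->
  (Np_neg ip H A K + Np_zero ip H A K + Np_pos ip H A K + Nc_plus A K
     <= N_A H A + N_K H K)%E.
Proof.
move=> ipn saLp saLm essLp essLm disLp disLm omp0 omm0 H A K noemb.
have hA : self_adjoint_in ip H A by exact: SA_opA essLm omm0.
have hK : self_adjoint_in ip H K by exact: SA_opK.
have Kt : forall u, H u -> exists k, K (u, k) by exact: opK_total essLm omm0.
have Kf : forall u k k', K (u, k) -> K (u, k') -> k = k' by exact: opK_functional.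
have Ki : forall u u' k, K (u, k) -> K (u', k) -> u = u' by exact: opK_injective.
have Af : forall u k k', A (u, k) -> A (u, k') -> k = k' by exact: opA_functional.
have K0 e : K (e, 0) -> e = 0 by move=> Ke; exact: Ki Ke (SA_0 hK).
have [NA|NA] := ltP (N_A H A) +oo%E; last first.
  move: NA; rewrite leye_eq => /eqP ->; rewrite addye ?leey //.
  by rewrite gt_eqF // (lt_le_trans _ (dim_ge0 _)) // ltNy0.
have [NK|NK] := ltP (N_K H K) +oo%E; last first.
  move: NK; rewrite leye_eq => /eqP ->; rewrite addey ?leey //.
  by rewrite gt_eqF // (lt_le_trans _ (dim_ge0 _)) // ltNy0.
have [sA [-> hsA]] := N_A_list hA NA.
have [sK [-> hsK]] := N_K_list hK K0 NK.
rewrite -EFinD -natrD.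
pose cnt := root_count ip A K.
have cnt0 g : (0 <= cnt g)%E by exact: root_count_ge0.
pose S1 := [set g | isolated_eigenvalue H (pencil A K) g /\ g < 0].
pose S2 := [set g | isolated_eigenvalue H (pencil A K) g /\ g = 0].
pose S3 := [set g | isolated_eigenvalue H (pencil A K) g /\ 0 < g].
pose S4 := [set g | Defs.eigenvalue (pencil A K) g /\ (0 < complex.Im g)%R].
apply: (@le_trans _ _ (\esum_(g in S1) cnt g + \esum_(g in S2) cnt g +
    \esum_(g in S3) cnt g + \esum_(g in S4) cnt g)%E).
  apply: leeD; first apply: leeD; first apply: leeD.
  - by apply: le_esum => g _; exact: root_count_Np.
  - by apply: le_esum => g _; exact: root_count_Np.
  - by apply: le_esum => g _; exact: root_count_Np.
  - by apply: le_esum => g [_ g0]; apply: root_count_dim; rewrite gt_eqF.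
rewrite !esumU //; last first.
- apply/seteqP; split => // g [[_ g0] [_ g1]]; by rewrite g1 ltxx in g0.
- apply/seteqP; split => // g [[[_ g0]|[_ g0]] [_ g1]].
    by have := lt_trans g0 g1; rewrite ltxx.
  by rewrite g0 ltxx in g1.
- apply/seteqP; split => // g [h [_ g1]]; move: g1.
  suff -> : complex.Im g = 0 by rewrite ltxx.
  case: h => [[[_]|[_ ->]]|[_]] //.
    by rewrite ltcE => /andP[/eqP <-].
  by rewrite ltcE => /andP[/eqP].
have real0 g : (S1 `|` S2 `|` S3) g -> complex.Im g = 0.
  case=> [[[_]|[_ ->]]|[_]] //.
    by rewrite ltcE => /andP[/eqP <-].
  by rewrite ltcE => /andP[/eqP].
apply: esum_le_seq => l ul hl.
apply: (root_count_sum hA hK Kt Kf Ki Af (omp := omp) (omm := omm)) => //.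
- exact: (opA_form_bound ipn saLp essLp essLm disLp omm0).
- exact: (opK_form_bound ipn saLm essLm disLm omm0).
- move=> g /hl[/real0 ->|[_ /ltW]] //.
- move=> g /hl hg g0; rewrite ltNge; apply/negP => le; apply: (noemb g); split.
    by case: hg => [[[[[]]|[[]]]|[[]]]|[]].
  by rewrite lecE /= g0 eqxx.
Qed.
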